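(* Let $A(D)$ be a homogeneous linear differential operator of order $k$ on $\mathbf{R}^n$ from $V$ to $E$. Let $p \in [1,n)$. If there exists $C>0$ such that for every $u \in C^\infty_c(\mathbf{R}^n;V)$, $$\int_{\mathbf{R}^n} \frac{|D^{k-1}u(x)|^p}{|x|^p}\,dx \le C\int_{\mathbf{R}^n} |A(D)u|^p,$$ then for every linear subspace $\Pi \subseteq \mathbf{R}^n$ such that $\dim \Pi \ge n-p$, there exists $\xi \in \Pi$ such that $A(\xi)$ is one-to-one.
   Context: Here $k \in \{1,2,\dots\}$ and $V$, $E$ are real finite-dimensional vector spaces (endowed with fixed inner products). A homogeneous linear differential operator $A(D)$ of order $k$ on $\mathbf{R}^n$ from $V$ to $E$ is an operator with constant coefficients $A(D)u = \sum_{\alpha \in \mathbf{N}^n, |\alpha|=k} A_\alpha[\partial^\alpha u] \in C^\infty(\mathbf{R}^n;E)$ for $u \in C^\infty(\mathbf{R}^n;V)$, where each $A_\alpha \in \mathcal{L}(V;E)$ is a linear map. For $\xi \in \mathbf{R}^n$, $A(\xi) = \sum_{|\alpha|=k} \xi^\alpha A_\alpha \in \mathcal{L}(V;E)$. $D^j u$ denotes the (total) derivative of order $j$ of $u$, with $D^0u=u$. *)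

(* Defs.v *)
From HB Require Import structures.
From mathcomp Require Import all_boot all_order all_algebra.
From mathcomp Require Import all_classical all_reals all_analysis.

Set Implicit Arguments.
Unset Strict Implicit.
Unset Printing Implicit Defensive.

Import Order.TTheory GRing.Theory Num.Theory.
Import numFieldNormedType.Exports.

Local Open Scope classical_set_scope.
Local Open Scope ring_scope.

HB.structure Definition NormedVector (R : realType) :=
  {V of NormedModule R V & Vector R V}.

(* Positive definiteness of [inner] follows from [euclid_norm], and the
   topology of V is the one of its Euclidean norm. *)
HB.mixin Record NormedVector_isEuclidean (R : realType) V
    of NormedModule R V & Vector R V := {
  inner : V -> V -> R ;
  innerC : forall x y, inner x y = inner y x ;
  inner_linearl : forall (a : R) x y z,
    inner (a *: x + y) z = a * inner x z + inner y z ;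
  euclid_norm : forall x, `|x| ^+ 2 = inner x x
}.

#[short(type="euclideanType")]
HB.structure Definition Euclidean (R : realType) :=
  {V of NormedVector R V & NormedVector_isEuclidean R V}.

Section lebesgue_tuple.
Context {R : realType}.
Local Open Scope ereal_scope.

Definition tuple_cons n (x : R * n.-tuple R) : n.+1.-tuple R :=
  [the n.+1.-tuple R of x.1 :: x.2].

Lemma measurable_tuple_cons n :
  measurable_fun [set: R * n.-tuple R] (@tuple_cons n).
Proof. exact: measurable_cons. Qed.

Section step.
Variables (n : nat) (m : {sigma_finite_measure set (n.-tuple R) -> \bar R}).

Definition lebesgue_step : set (n.+1.-tuple R) -> \bar R :=
  pushforward (lebesgue_measure \x m) (@tuple_cons n).

Let preim (A : set (n.+1.-tuple R)) :
  measurable A -> measurable (@tuple_cons n @^-1` A).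
Proof.
by move=> mA; rewrite -[X in measurable X]setTI; exact: measurable_tuple_cons.
Qed.

Let step0 : lebesgue_step set0 = 0.
Proof. by rewrite /lebesgue_step /pushforward preimage_set0 measure0. Qed.

Let step_ge0 A : 0 <= lebesgue_step A.
Proof. exact: integral_ge0. Qed.

Let step_sigma_additive : semi_sigma_additive lebesgue_step.
Proof.
move=> F mF tF mUF; rewrite /lebesgue_step /pushforward preimage_bigcup.
apply: measure_semi_sigma_additive.
- by move=> i; exact: preim.
- apply/trivIsetP => /= i j _ _ ij; rewrite -preimage_setI.
  by move/trivIsetP : tF => /(_ _ _ _ _ ij) ->//; rewrite preimage_set0.
- by rewrite -preimage_bigcup; exact: preim.
Qed.

HB.instance Definition _ := isMeasure.Build _ _ _ lebesgue_step
  step0 step_ge0 step_sigma_additive.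

Lemma lebesgue_stepE (A : set R) (B : set (n.-tuple R)) :
  measurable A -> measurable B ->
  lebesgue_step [set t | A (thead t) /\ B [tuple of behead t]] =
  lebesgue_measure A * m B.
Proof.
move=> mA mB; rewrite -product_measure1E// /lebesgue_step /pushforward.
congr (product_measure1 _ _ _); apply/seteqP.
have tlE x (t : n.-tuple R) : [tuple of behead (x :: t)] = t by exact/val_inj.
by split=> -[x t] /=; rewrite theadE tlE.
Qed.

Lemma measurable_step (A : set R) (B : set (n.-tuple R)) :
  measurable A -> measurable B ->
  measurable [set t : n.+1.-tuple R | A (thead t) /\ B [tuple of behead t]].
Proof.
move=> mA mB; apply: measurableI.
  rewrite -[X in measurable X]setTI.
  exact: (@measurable_tnth _ _ n.+1 ord0).
rewrite -[X in measurable X]setTI.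
exact: (@measurable_behead _ _ n).
Qed.

Let step_sigma_finite : sigma_finite setT lebesgue_step.
Proof.
have /sigma_finiteP[F [UF ndF mF]] :=
  @sigma_finiteT _ _ _ (@lebesgue_measure R).
have /sigma_finiteP[G [UG ndG mG]] := sigma_finiteT m.
exists (fun i => [set t | F i (thead t) /\ G i [tuple of behead t]]).
  apply/seteqP; split=> // t _.
  have : setT (thead t) by []. rewrite UF => -[i _ Fi].
  have : setT [tuple of behead t] by []. rewrite UG => -[j _ Gj].
  exists (maxn i j) => //; split.
    by move: Fi; apply/subsetPset/ndF; exact: leq_maxl.
  by move: Gj; apply/subsetPset/ndG; exact: leq_maxr.
move=> i; have [mFi Foo] := mF i; have [mGi Goo] := mG i.
split; first exact: measurable_step.
by rewrite lebesgue_stepE// lte_mul_pinfty// ge0_fin_numE.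
Qed.

HB.instance Definition _ :=
  Measure_isSigmaFinite.Build _ _ _ lebesgue_step step_sigma_finite.

End step.

(* Lebesgue measure on R^n: iterated product of the one-dimensional measure. *)
Fixpoint lebesgue_tuple n : {sigma_finite_measure set (n.-tuple R) -> \bar R} :=
  if n is n'.+1 then lebesgue_step (lebesgue_tuple n') else \d_[tuple].

Lemma lebesgue_tuple_box n (a b : n.-tuple R) :
  (forall i, tnth a i <= tnth b i)%R ->
  lebesgue_tuple n [set t | forall i, tnth a i <= tnth t i <= tnth b i]%R =
  (\prod_(i < n) (tnth b i - tnth a i))%:E.
Proof.
elim: n a b => [|n IHn] a b ab.
  by rewrite big_ord0 /= diracE mem_set//; case.
rewrite big_ord_recl EFinM /=.
pose B := [set t : n.-tuple R | forall i, tnth [tuple of behead a] i <=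
  tnth t i <= tnth [tuple of behead b] i]%R.
have tl (t : n.+1.-tuple R) i : tnth [tuple of behead t] i = tnth t (lift ord0 i).
  by rewrite [in RHS](tuple_eta t) tnthS.
have mB : measurable B.
  rewrite (_ : B = \bigcap_(i in [set: 'I_n]) (@tnth n R ^~ i @^-1`
      `[tnth [tuple of behead a] i, tnth [tuple of behead b] i])); last first.
    apply/seteqP; split=> t Bt i => [_|]; first by rewrite /= in_itv; exact: Bt.
    by have := Bt i I; rewrite /= in_itv.
  apply: fin_bigcap_measurable => // i _.
  rewrite -[X in measurable X]setTI.
  by apply: (@measurable_tnth _ _ n i) => //; exact: measurable_itv.
rewrite (_ : [set t | _] = [set t | `[thead a, thead b]%classic (thead t) /\
    B [tuple of behead t]]); last first.
  apply/seteqP; split=> t /=.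
    move=> Ht; split; first by rewrite in_itv; exact: Ht.
    by move=> i; rewrite !tl; exact: Ht.
  rewrite in_itv => -[t0 Bt] i.
  by case: (unliftP ord0 i) => [j ->|->//]; rewrite -!tl; exact: Bt.
rewrite lebesgue_stepE// lebesgue_measure_itv IHn; last first.
  by move=> i; rewrite !tl; exact: ab.
under [in RHS]eq_bigr do rewrite -!tl.
congr (_ * _); rewrite /= lte_fin /thead.
have := ab ord0; rewrite le_eqVlt => /predU1P[->|->]; last by rewrite EFinB.
by rewrite ltxx subrr.
Qed.
End lebesgue_tuple.

Section calculus.
Context {R : realType} {n : nat}.
Implicit Types (V E : euclideanType R) (x xi : 'rV[R]_n).

(* Euclidean norm; the library norm on 'rV[R]_n is the sup norm. *)
Definition enorm x : R := Num.sqrt (\sum_i x 0 i ^+ 2).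

Definition ebasis (i : 'I_n) : 'rV[R]_n := delta_mx 0 i.

Definition integral_Rn (f : 'rV[R]_n -> R) : \bar R :=
  (\int[lebesgue_tuple n]_t (f (\row_i tnth t i))%:E)%E.

(* 'D_h1 ('D_h2 ( ... u)) for hs = [:: h1; h2; ...] *)
Definition iter_derive V (hs : seq 'rV[R]_n) (u : 'rV[R]_n -> V) :
    'rV[R]_n -> V :=
  foldr (fun h f => 'D_h f) u hs.

Definition smooth V (u : 'rV[R]_n -> V) : Prop :=
  forall s : seq 'I_n,
    continuous (iter_derive (map ebasis s) u) /\
    forall (i : 'I_n) x, derivable (iter_derive (map ebasis s) u) x (ebasis i).

Definition compactly_supported V (u : 'rV[R]_n -> V) : Prop :=
  compact (closure [set x | u x != 0]).

Definition test_function V (u : 'rV[R]_n -> V) : Prop :=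
  smooth u /\ compactly_supported u.

(* For smooth u, the value of the symmetric multilinear map D^j u(x). *)
Definition total_derivative V (j : nat) (u : 'rV[R]_n -> V) x
    (hs : j.-tuple 'rV[R]_n) : V :=
  iter_derive hs u x.

(* Euclidean (Frobenius) norm of j-linear maps on R^n. *)
Definition multilinear_norm V (j : nat) (T : j.-tuple 'rV[R]_n -> V) : R :=
  Num.sqrt (\sum_(s : j.-tuple 'I_n) `|T (map_tuple ebasis s)| ^+ 2).

Definition multiindex (k : nat) : Type :=
  {alpha : {ffun 'I_n -> 'I_k.+1} | (\sum_i alpha i == k)%N}.

HB.instance Definition _ k := Finite.on (multiindex k).

Definition partial V k (alpha : multiindex k) (u : 'rV[R]_n -> V) :
    'rV[R]_n -> V :=
  iter_derive (flatten [seq nseq (val alpha i) (ebasis i) | i <- enum 'I_n]) u.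

Definition diff_op V E k (A : multiindex k -> 'Hom(V, E))
    (u : 'rV[R]_n -> V) : 'rV[R]_n -> E :=
  fun x => \sum_(alpha : multiindex k) A alpha (partial alpha u x).

Definition symbol V E k (A : multiindex k -> 'Hom(V, E)) xi : 'Hom(V, E) :=
  \sum_(alpha : multiindex k) (\prod_i xi 0 i ^+ val alpha i) *: A alpha.

End calculus.
Arguments multiindex : clear implicits.
Arguments total_derivative {R n V} j u x hs.

(* Main.v *)
From HB Require Import structures.
Require Import Defs.
From mathcomp Require Import all_boot all_order all_algebra.
From mathcomp Require Import all_classical all_reals all_analysis.
From mathcomp Require Import measurable_realfun.
From mathcomp Require mpoly.
Import -(notations) mpoly.
From mathcomp Require Import ssrcomplements.
From mathcomp Require Import ring lra.

Set Implicit Arguments.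
Unset Strict Implicit.
Unset Printing Implicit Defensive.

Import Order.TTheory GRing.Theory Num.Theory.
Import numFieldNormedType.Exports.

Local Open Scope ring_scope.

(** Suppose that the symbol is singular at every frequency of [Pi].  The idea is
    to build compactly supported fields that vary at a small scale in the
    directions of [Pi], are annihilated to leading order by the operator, and
    concentrate near a complementary subspace of dimension at most [p], along
    which the Hardy weight [|x| ^ (- p)] is not integrable.

    Singularity on [Pi] is an algebraic fact about the symbol restricted to
    [Pi], a matrix of polynomials: over the field of fractions it has a kernel
    vector, and clearing denominators gives a nonzero polynomial vector [v] with
    [A(xi) v(xi) = 0] identically on [Pi] ([poly_row_kernel],
    [symbol_kernel_field]).  Hence, for every scalar test function [F] on
    [Pi], the operator kills the field [v(D) F].

    Since the Lebesgue measure is an iterated product, rotations are replaced by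
    shears.  An echelon basis of [Pi] ([echelon_basis]) extends to linear forms
    [l_i] with unitriangular matrix, so that boxes in the coordinates
    [l_i] have the expected volume ([slab_box_measure]).  The test function is
    [F(x) = prod_i th_i (lam_i l_i(x))] with [lam_i = lam] large for the forms in
    [Pi] and [lam_i = 1] for the others: a derivative of [F] in a direction [h]
    amounts to multiplication by the polynomial [sum_i lam_i l_i(h) X_i], so the
    whole differential calculus of the fields [v(D) F] is carried out on
    polynomials ([is_diff_act], [iter_derive_wave_field]).

    Two estimates then clash.  On one hand the coefficient of [lam ^ k] in
    [A(D) v(D) F] vanishes, so this field is [O(lam ^ (k - 1))] on a box of
    volume comparable to [lam ^ (- m)], where [m >= dim Pi] is the number of
    forms in [Pi] ([diff_op_squeezed_le]).  On the other hand each [th_i] equals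
    [exp (s_i t)] near [0], for a point [s] at which the relevant polynomials
    do not vanish, so some derivative of order [k - 1] is at least
    [c lam ^ (k - 1)] on a box of comparable size
    ([total_derivative_squeezed_ge]).  On that box the weight [|x| ^ (- p)], with
    [p >= n - m], contributes the same amount [c lam ^ (- m)] on each of the
    [log lam] dyadic scales between [1 / lam] and [1] ([log_divergence]).  A
    Hardy inequality would bound [log lam] uniformly in [lam]. *)

(** * Linear algebra over polynomial rings *)

Lemma digits_inj (b : nat) n (f g : 'I_n -> nat) :
  (forall i, f i < b)%N -> (forall i, g i < b)%N ->
  (\sum_(i < n) f i * b ^ i = \sum_(i < n) g i * b ^ i)%N -> f =1 g.
Proof.
elim: n f g => [|n IHn] f g fb gb; first by move=> _ [].
have tailE (h : 'I_n.+1 -> nat) : (\sum_(i < n.+1) h i * b ^ i =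
    (\sum_(i < n) h (lift ord0 i) * b ^ i) * b + h ord0)%N.
  rewrite big_ord_recl expn0 muln1 addnC big_distrl /=; congr addn.
  by apply: eq_bigr => i _; rewrite /bump /= add1n expnSr mulnA.
have b0 : (0 < b)%N by exact: leq_ltn_trans (fb ord0).
rewrite !tailE => e i.
have e0 : f ord0 = g ord0.
  by move/(congr1 (modn^~ b)): e; rewrite !modnMDl !modn_small.
have /IHn eS : (\sum_(i < n) f (lift ord0 i) * b ^ i =
                \sum_(i < n) g (lift ord0 i) * b ^ i)%N.
  by apply/eqP; rewrite -(eqn_pmul2r b0) -(eqn_add2r (f ord0)) {2}e0 e.
by case: (unliftP ord0 i) => [j|] ->; [exact: eS|].
Qed.

Lemma poly_nonroot (F : numFieldType) (q : {poly F}) :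
  q != 0 -> exists t, q.[t] != 0.
Proof.
move=> q0; pose s : seq F := [seq i%:R | i <- iota 0 (size q)].
have us : uniq s by rewrite map_inj_uniq ?iota_uniq//; exact: mulrIn (oner_neq0 F).
have /allPn[t _ qt] : ~~ all (root q) s.
  apply/negP => /max_poly_roots/(_ us).
  by rewrite q0 size_map size_iota ltnn => /(_ isT).
by exists t.
Qed.

(** Kronecker substitution: evaluating the variable [i] at [t ^ (b ^ i)], with
    [b] larger than all exponents, sends distinct monomials to distinct powers
    of [t], which reduces the claim to one variable. *)
Lemma mpoly_nonroot (F : numFieldType) n (q : mpoly n F) :
  q != 0 -> exists s : 'I_n -> F, meval s q != 0.
Proof.
move=> q0; pose b := msize q; pose e (m : multinom n) := (\sum_(i < n) m i * b ^ i)%N.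
have mb m i : m \in msupp q -> (m i < b)%N.
  move=> mq; apply: leq_ltn_trans (msize_mdeg_lt mq).
  by rewrite mdegE (bigD1 i) //= leq_addr.
have e_inj : {in msupp q &, injective e}.
  move=> m m' mq m'q /digits_inj mm'; apply/mnmP => i.
  by apply: mm' => j; exact: mb.
pose P : {poly F} := \sum_(m <- msupp q) mcoeff m q *: 'X^(e m).
have evP t : meval (fun i => t ^+ (b ^ i)) q = P.[t].
  rewrite mevalE horner_sum; apply: eq_bigr => m _.
  rewrite hornerZ hornerXn -prodrXr /=; congr (_ * _).
  by apply: eq_bigr => i _; rewrite -exprM mulnC.
have P0 : P != 0.
  have [m mq] : exists m, m \in msupp q.
    move: q0; rewrite -msupp_eq0; case: (msupp q) => // m s _.
    by exists m; rewrite mem_head.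
  apply/eqP => /(congr1 (fun P : {poly F} => P`_(e m))).
  rewrite coef0 coef_sum (bigD1_seq m) ?msupp_uniq//= coefZ coefXn eqxx mulr1.
  rewrite big_seq_cond big1 ?addr0; last first.
    move=> m' /andP[m'q m'm]; rewrite coefZ coefXn.
    case: eqP => [/e_inj mm'|]; last by rewrite mulr0.
    by rewrite mm' ?eqxx in m'm.
  by apply/eqP; rewrite -mcoeff_msupp.
by have [t Pt] := poly_nonroot P0; exists (fun i => t ^+ (b ^ i)); rewrite evP.
Qed.

Section clear_denominators.
Variable D : idomainType.
Local Notation tofrac := (@FracField.tofrac D).

Lemma fraction_numden (x : {fraction D}) :
  exists2 d, d != 0 & exists c, tofrac d * x = tofrac c.
Proof.
elim/quotW: x => y; exists (frac y).2; first exact: denom_ratioP.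
exists (frac y).1; rewrite !piE; apply/eqmodP.
rewrite /= FracField.equivfE /FracField.mulf.
rewrite !numden_Ratio ?oner_eq0 ?mulf_neq0 ?denom_ratioP ?oner_eq0//.
by rewrite !mulr1 !mul1r.
Qed.

Lemma mx_clear_denominators m n (X : 'M[{fraction D}]_(m, n)) :
  exists2 d, d != 0 & exists N, tofrac d *: X = map_mx tofrac N.
Proof.
have /fin_all_exists2[d d0 /fin_all_exists[c dX]] ij :=
  fraction_numden (X ij.1 ij.2).
exists (\prod_ij d ij); first by apply/prodf_neq0.
exists (\matrix_(i, j) (c (i, j) * \prod_(ij | ij != (i, j)) d ij)).
apply/matrixP => i j; rewrite !mxE (bigD1 (i, j))//= mulrC rmorphM mulrA.
by rewrite [X i j * _]mulrC (dX (i, j)) rmorphM.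
Qed.
End clear_denominators.

(** Without a kernel vector over the fraction field, [M] would have a right
    inverse there; clearing denominators, [M N = d I] with [d] a nonzero
    polynomial, so that [M] has no left kernel at the points where [d] does not
    vanish. *)
Lemma poly_row_kernel (F : numFieldType) k m n
    (M : 'M[mpoly k F]_(m, n)) :
  (forall s : 'I_k -> F,
    exists2 v : 'rV_m, v != 0 & v *m map_mx (meval s) M = 0) ->
  exists2 v : 'rV_m, v != 0 & v *m M = 0.
Proof.
move=> kerM; pose toK := @FracField.tofrac (mpoly k F).
have toK_inj : injective toK.
  by move=> x y /eqP; rewrite tofrac_eq => /eqP.
have mxK_inj (a b : nat) : injective (@map_mx _ _ toK a b).
  move=> X Y /matrixP XY; apply/matrixP => i j.
  by have := XY i j; rewrite !mxE => /toK_inj.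
have [/row_freeP[B MB]|] := boolP (row_free (map_mx toK M)).
  have [d d0 [N BN]] := mx_clear_denominators B.
  have MN : M *m N = d%:M.
    apply: mxK_inj.
    by rewrite map_mxM -BN -scalemxAr MB map_scalar_mx scalemx1.
  have [s ds] := mpoly_nonroot d0; have [v v0 vM] := kerM s.
  have := congr1 (mulmx v) (congr1 (map_mx (meval s)) MN).
  rewrite map_mxM mulmxA vM mul0mx map_scalar_mx mul_mx_scalar => /esym/eqP.
  by rewrite scaler_eq0 (negPf ds) (negPf v0).
rewrite -kermx_eq0 => /rowV0Pn[w /sub_kermxP wM w0].
have [d d0 [v wv]] := mx_clear_denominators w.
exists v.
  apply: contra w0 => /eqP v0; move: wv; rewrite v0 map_mx0 => /eqP.
  by rewrite scaler_eq0 tofrac_eq0 (negPf d0).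
apply: mxK_inj.
by rewrite map_mxM -wv -scalemxAl wM scaler0 map_mx0.
Qed.

(** * Echelon bases of a subspace *)

(** The pivots are the positions of the first nonzero coordinates of the vectors
    of [Pi].  A vector of [Pi] that vanishes at all pivots is zero, so there are
    at least [dim Pi] of them.  The echelon form is what makes the coordinates
    [row i L] compatible with an iterated integral. *)
Lemma echelon_basis (F : fieldType) n (Pi : {vspace 'rV[F]_n}) :
  exists (I : {set 'I_n}) (L : 'M[F]_n),
    [/\ forall i j : 'I_n, (j < i)%N -> L i j = 0, forall i, L i i = 1,
        forall i, i \in I -> row i L \in Pi & (\dim Pi <= #|I|)%N].
Proof.
pose piv (i : 'I_n) (v : 'rV[F]_n) :=
  [/\ v \in Pi, forall j : 'I_n, (j < i)%N -> v 0 j = 0 & v 0 i = 1].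
pose I := [set i | `[< exists v, piv i v >]].
have /fin_all_exists[l lP] i : exists v : 'rV[F]_n,
    if i \in I then piv i v else v = delta_mx 0 i.
  by rewrite inE; case: asboolP => [//|_]; exists (delta_mx 0 i).
exists I, (\matrix_i l i); split.
- move=> i j ji; have := lP i; case: ifP => _ [] /=; rewrite !mxE.
    by move=> _ /(_ _ ji).
  by move=> ->; rewrite mxE eqxx -val_eqE ltn_eqF.
- move=> i; have := lP i; case: ifP => _; first by case=> _ _; rewrite mxE.
  by move=> li; rewrite mxE li mxE !eqxx.
- by move=> i iI; rewrite rowK; have := lP i; rewrite iI => -[].
pose f (v : 'rV[F]_n) : 'rV[F]_#|I| := \row_k v 0 (enum_val k).
have f_lin : linear f by move=> a u v; apply/rowP => k; rewrite !mxE.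
pose f' := HB.pack_for {linear 'rV[F]_n -> 'rV[F]_#|I|} f
  (GRing.isLinear.Build _ _ _ _ f f_lin).
have kerf : (Pi :&: lker (linfun f') = 0)%VS.
  apply/eqP; rewrite -subv0; apply/subvP => v.
  rewrite memv_cap memv_ker lfunE /= memv0 => /andP[vPi /eqP fv].
  apply: contraT => v0.
  have [i0 vi0] : exists i, v 0 i != 0.
    apply: contraNP v0 => /forallNP v0; apply/eqP/rowP => i; rewrite mxE.
    by apply/eqP; move: (v0 i) => /negP; rewrite negbK.
  have [i vi imin] := @arg_minnP _ i0 (fun i => v 0 i != 0) (@nat_of_ord n) vi0.
  suff iI : i \in I.
    move/rowP/(_ (enum_rank_in iI i)): fv vi.
    by rewrite !mxE enum_rankK_in// => ->; rewrite eqxx.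
  rewrite inE; apply/asboolP; exists ((v 0 i)^-1 *: v); split.
  - exact: memvZ.
  - move=> j ji; rewrite mxE; have [->|/imin] := eqVneq (v 0 j) 0.
      by rewrite mulr0.
    by rewrite leqNgt ji.
  - by rewrite mxE mulVf.
rewrite -(limg_dim_eq kerf); apply: leq_trans (dimvS (subvf _)) _.
by rewrite dimvf /dim /= mul1n.
Qed.

(** * Smooth cutoffs on the line *)

Section smooth1.
Local Open Scope classical_set_scope.
Local Open Scope ring_scope.

Context {R : realType}.
Implicit Types (f g : R -> R) (k : nat) (P : {poly R}).

(** An inductive form of differentiability of order [k], chosen so that the
    closure properties below follow by a plain induction on the order. *)
Fixpoint kderivable k f : Prop :=
  if k is k'.+1 then
    exists2 g : R -> R, (forall t : R, is_derive t (1 : R) f (g t)) & kderivable k' g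
  else True.

Lemma kderivableS k f : kderivable k.+1 f -> kderivable k f.
Proof. by elim: k f => // k IHk f [g fg /IHk]; exists g. Qed.

Lemma kderivable_cst k (c : R) : kderivable k (fun=> c).
Proof.
elim: k c => // k IHk c; exists (fun=> 0) => [t|]; last exact: IHk.
exact: is_derive_cst.
Qed.

Lemma kderivable_id k : kderivable k (fun t => t).
Proof.
case: k => // k; exists (fun=> 1) => [t|]; last exact: kderivable_cst.
exact: is_derive_id.
Qed.

Lemma kderivableD k f g : kderivable k f -> kderivable k g ->
  kderivable k (fun t => f t + g t).
Proof.
elim: k f g => // k IHk f g [f' ff' kf'] [g' gg' kg'].
by exists (fun t => f' t + g' t) => [t|]; [exact: is_deriveD|exact: IHk].
Qed.

Lemma kderivableM k f g : kderivable k f -> kderivable k g ->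
  kderivable k (fun t => f t * g t).
Proof.
elim: k f g => // k IHk f g kf kg.
have [[f' ff' kf'] [g' gg' kg']] := (kf, kg).
exists (fun t => f t * g' t + g t * f' t) => [t|]; first exact: is_deriveM.
by apply: kderivableD; apply: IHk => //; exact: kderivableS.
Qed.

Lemma kderivable_comp k f g : kderivable k f -> kderivable k g ->
  kderivable k (fun t => f (g t)).
Proof.
elim: k f g => // k IHk f g [f' ff' kf'] kg; have [g' gg' kg'] := kg.
exists (fun t => f' (g t) * g' t) => [t|]; first exact: is_derive1_comp.
by apply: kderivableM => //; apply: IHk => //; exact: kderivableS.
Qed.

Lemma kderivableV k f : (forall t, f t != 0) -> kderivable k f ->
  kderivable k (fun t => (f t)^-1).
Proof.
move=> f0; elim: k => // k IHk kf; have [f' ff' kf'] := kf.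
exists (fun t => - 1 * ((f t)^-1 * (f t)^-1 * f' t)) => [t|]; last first.
  apply: kderivableM; first exact: kderivable_cst.
  by do 2?[apply: kderivableM => //]; apply: IHk; exact: kderivableS.
have := is_deriveV (f0 t) (ff' t).
rewrite mulN1r scaleNr.
by rewrite -exprVn expr2.
Qed.

Lemma kderivable_expR k (s : R) : kderivable k (fun t => expR (s * t)).
Proof.
elim: k => // k IHk; exists (fun t => expR (s * t) * s) => [t|]; last first.
  by apply: kderivableM => //; exact: kderivable_cst.
apply: is_derive1_comp.
have := @is_deriveZ R R R id s t 1 1 (is_derive_id t 1).
by rewrite /GRing.scale/= mulr1.
Qed.

Lemma poly_le_expR P : exists2 C : R, 0 <= C &
  forall s, 0 <= s -> `|P.[s]| <= C * expR s.
Proof.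
exists (\sum_(i < size P) `|P`_i| * i`!%:R).
  by apply: sumr_ge0 => i _; rewrite mulr_ge0.
move=> s s0; rewrite horner_coef mulr_suml.
apply: le_trans (ler_norm_sum _ _ _) _; apply: ler_sum => i _.
rewrite normrM -mulrA ler_wpM2l// normrX ger0_norm// mulrC.
rewrite -ler_pdivrMr ?ltr0n ?fact_gt0//.
case: (nat_of_ord i) => [|j].
  by rewrite expr0 fact0 divr1 (le_trans _ (expR_ge1Dx _))// lerDl.
by rewrite (le_trans _ (expR_ge1Dxn j s0))// lerDr.
Qed.

(** The form in which flatness at the origin is used: it gives the derivative
    there without computing any limit of [exp (-1/t)]. *)
Lemma is_derive_quadratic f (C : R) :
  (forall h, `|f h| <= C * h ^+ 2) -> is_derive (0 : R) (1 : R) f 0.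
Proof.
move=> fC; have f0 : f 0 = 0.
  by apply/eqP; rewrite -normr_le0 (le_trans (fC 0))// expr0n mulr0.
have C0 : 0 <= C by have := le_trans (normr_ge0 _) (fC 1); rewrite expr1n mulr1.
have lim0 : h^-1 *: ((f \o shift 0) (h *: (1 : R)) - f 0)
    @[h --> (0 : R)^'] --> (0 : R).
  apply/cvgrPdist_le => e e0.
  near=> h; rewrite sub0r normrN /= f0 subr0 addr0.
  have h0 : h != 0 by near: h; exact: nbhs_dnbhs_neq.
  rewrite [h *: 1]mulr1 normrZ normfV ler_pdivrMl ?normr_gt0//.
  rewrite (le_trans (fC h))// -real_normK ?num_real// expr2 mulrA mulrC ler_wpM2l//.
  have : `|h| <= e / (C + 1).
    near: h; apply: dnbhs0_le; rewrite divr_gt0//; lra.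
  rewrite ler_pdivlMr; last lra.
  have := normr_ge0 h; nra.
by split; [apply/cvg_ex; exists 0|exact: cvg_lim lim0].
Unshelve. all: by end_near.
Qed.

(** This family contains [exp (-1/t)], extended by zero, and is stable under
    derivation, so that smoothness can be proved for all its members at once. *)
Definition flat P (t : R) : R := if 0 < t then P.[t^-1] * expR (- t^-1) else 0.

Lemma flat_quadratic P : exists C : R, forall t, `|flat P t| <= C * t ^+ 2.
Proof.
have [C C0 PC] := poly_le_expR (P * 'X^2).
exists C => t; rewrite /flat; case: ltP => t0; last first.
  by rewrite normr0 mulr_ge0// sqr_ge0.
have := PC t^-1; rewrite invr_ge0 (ltW t0) => /(_ isT).
rewrite hornerM hornerXn normrM (ger0_norm (sqr_ge0 _)) => Pt.
rewrite normrM (ger0_norm (expR_ge0 _)) expRN ler_pdivrMr ?expR_gt0//.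
rewrite -[`|P.[_]|](@mulfK _ (t ^- 2)) ?invr_eq0 ?expf_neq0 ?gt_eqF//.
by rewrite invrK [leRHS]mulrAC ler_wpM2r ?sqr_ge0// -exprVn.
Qed.

Lemma is_derive_flat P (t : R) :
  is_derive t (1 : R) (flat P) (flat ('X^2 * (P - P^`())) t).
Proof.
have flat0 Q s : s <= 0 -> flat Q s = 0 by rewrite /flat ltNge => ->.
have [->|] := eqVneq t 0; last (rewrite neq_lt => /orP[] t0).
- have [C PC] := flat_quadratic P; rewrite flat0//.
  exact: is_derive_quadratic PC.
- rewrite flat0 ?ltW//.
  have d0 : is_derive t (1 : R) (fun=> 0 : R) 0 by exact: is_derive_cst.
  apply: near_eq_is_derive d0.
  near=> s; rewrite flat0// ltW//.
  by near: s; exact: lt_nbhsl.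
- have tN0 : t != 0 by rewrite gt_eqF.
  have dV : is_derive t (1 : R) (fun t => t^-1) (- t^-1 ^+ 2).
    have := is_deriveV tN0 (is_derive_id t (1 : R)).
    by rewrite /GRing.scale/= mulr1 exprVn.
  have dP : is_derive t (1 : R) (fun t => P.[t^-1]) (P^`().[t^-1] * - t^-1 ^+ 2).
    exact: is_derive1_comp.
  have dE : is_derive t (1 : R) (fun t => expR (- t^-1))
      (expR (- t^-1) * - - t^-1 ^+ 2).
    by apply: is_derive1_comp; exact: is_deriveN.
  have dPE : is_derive t (1 : R) (fun t => P.[t^-1] * expR (- t^-1))
      (flat ('X^2 * (P - P^`())) t).
    have -> : flat ('X^2 * (P - P^`())) t =
        P.[t^-1] * (expR (- t^-1) * - - t^-1 ^+ 2) +
        expR (- t^-1) * (P^`().[t^-1] * - t^-1 ^+ 2).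
      by rewrite /flat t0 hornerM hornerXn hornerD hornerN; ring.
    exact: is_deriveM.
  apply: near_eq_is_derive dPE.
  near=> s; rewrite /flat ifT//.
  by near: s; exact: lt_nbhsr.
Unshelve. all: by end_near.
Qed.

Lemma kderivable_flat k P : kderivable k (flat P).
Proof.
elim: k P => // k IHk P; exists (flat ('X^2 * (P - P^`()))) => // t.
exact: is_derive_flat.
Qed.

Lemma flat1_gt0 (t : R) : 0 < t -> 0 < flat 1 t.
Proof. by move=> t0; rewrite /flat t0 hornerC mul1r expR_gt0. Qed.

Lemma flat_le0 P (t : R) : t <= 0 -> flat P t = 0.
Proof. by rewrite /flat ltNge => ->. Qed.

Lemma flat1_ge0 (t : R) : 0 <= flat 1 t.
Proof. by rewrite /flat; case: ifP => // _; rewrite hornerC mul1r expR_ge0. Qed.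

(** The usual quotient [f(a) / (f(a) + f(b))] of flat functions; its denominator
    is positive because [a t = 1 - t ^ 2] and [b t = t ^ 2 - 1 / 4] are never both
    nonpositive. *)
Lemma smooth_plateau : exists2 chi : R -> R, forall k, kderivable k chi &
  (forall t, `|t| <= 2^-1 -> chi t = 1) /\ (forall t, 1 <= `|t| -> chi t = 0).
Proof.
pose a (t : R) := 1 + - 1 * (t * t); pose b (t : R) := - 4^-1 + t * t.
have ka k : kderivable k a.
  apply: kderivableD; first exact: kderivable_cst.
  apply: kderivableM; first exact: kderivable_cst.
  by apply: kderivableM; exact: kderivable_id.
have kb k : kderivable k b.
  apply: kderivableD; first exact: kderivable_cst.
  by apply: kderivableM; exact: kderivable_id.
have den0 t : flat 1 (a t) + flat 1 (b t) != 0.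
  rewrite gt_eqF//; have [at0|at0] := ltP 0 (a t).
    by rewrite ltr_wpDr ?flat1_ge0// flat1_gt0.
  by rewrite ltr_wpDl ?flat1_ge0// flat1_gt0//; move: at0; rewrite /a /b; lra.
exists (fun t => flat 1 (a t) * (flat 1 (a t) + flat 1 (b t))^-1) => [k|].
  have kfa : kderivable k (fun t => flat 1 (a t)).
    by apply: kderivable_comp => //; exact: kderivable_flat.
  have kfb : kderivable k (fun t => flat 1 (b t)).
    by apply: kderivable_comp => //; exact: kderivable_flat.
  by apply: kderivableM => //; apply: kderivableV => //; exact: kderivableD.
split=> t; rewrite -(@ler_pXn2r _ 2)// ?nnegrE// -normrX.
all: rewrite ger0_norm ?sqr_ge0// expr2 => tt.
  have := den0 t; rewrite (@flat_le0 1 (b t)); last first.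
    by move: tt; rewrite /b expr2 -invfM; lra.
  by rewrite addr0 => /divff.
by rewrite (@flat_le0 1 (a t)) ?mul0r//; move: tt; rewrite /a expr2; lra.
Qed.

Lemma derive1n_chain f : (forall k, kderivable k f) ->
  forall b t, is_derive t (1 : R) (derive1n b f) (derive1n b.+1 f t).
Proof.
move=> kf b; have {kf} : kderivable b.+1 f by [].
elim: b f => [|b IHb] f [g fg kg] t.
  rewrite derive1nS derive1n0 derive1E; have := fg t => h.
  by split; [exact: ex_derive|].
have -> : derive1n b.+1 f = derive1n b g.
  rewrite derive1Sn; congr derive1n; apply/funext => s.
  by rewrite derive1E; exact: derive_val.
have -> : derive1n b.+2 f = derive1n b.+1 g.
  rewrite derive1Sn; congr derive1n; apply/funext => s.
  by rewrite derive1E; exact: derive_val.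
exact: IHb.
Qed.

(** On the plateau, derivation acts on the cutoff exponential as multiplication
    by [s]; this is how a polynomial in the derivatives is kept away from zero
    later, by choosing [s] off its zero set. *)
Lemma exponential_bump (s : R) : exists th : nat -> R -> R,
  [/\ forall b t, is_derive t (1 : R) (th b) (th b.+1 t),
      forall b t, `|t| < 2^-1 -> th b t = s ^+ b * expR (s * t),
      forall b t, 1 < `|t| -> th b t = 0 &
      forall b, exists C : R, forall t, `|th b t| <= C].
Proof.
have [chi kchi [chi1 chi0]] := smooth_plateau.
pose f t := chi t * expR (s * t).
have kf k : kderivable k f by apply: kderivableM => //; exact: kderivable_expR.
have df := derive1n_chain kf.
have th0 b t : 1 < `|t| -> derive1n b f t = 0.
  elim: b t => [|b IHb] t t1; first by rewrite derive1n0 /f chi0 ?mul0r// ltW.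
  have := df b t => /(@derive_val _ _ _ _ _ _ _) <-.
  rewrite (@near_eq_derive _ _ _ _ (fun=> 0 : R)) ?derive_cst//.
  near=> u; apply: IHb; near: u.
  exact: (norm_continuous (lt_nbhsr t1)).
exists (fun b => derive1n b f); split => // b.
- elim: b => [|b IHb] t t2; first by rewrite derive1n0 /f chi1 ?expr0// ltW.
  have := df b t => /(@derive_val _ _ _ _ _ _ _) <-.
  rewrite (@near_eq_derive _ _ _ _ (fun t => s ^+ b * expR (s * t))); last first.
    near=> u; apply: IHb; near: u.
    exact: (norm_continuous (lt_nbhsl t2)).
  have dE : is_derive t (1 : R) (fun t => expR (s * t)) (expR (s * t) * s).
    apply: is_derive1_comp.
    have := @is_deriveZ R R R id s t 1 1 (is_derive_id t 1).
    by rewrite /GRing.scale/= mulr1.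
  have -> : s ^+ b.+1 * expR (s * t) = s ^+ b *: (expR (s * t) * s).
    by rewrite /GRing.scale/= exprS; ring.
  have dZ := @is_deriveZ R R R (fun t => expR (s * t)) (s ^+ b) t 1 _ dE.
  exact: derive_val.
- have cf : continuous (fun t => `|derive1n b f t|).
    move=> t; apply: cvg_norm; apply: differentiable_continuous.
    by apply/derivable1_diffP; have := df b t => dft; exact: ex_derive.
  have [c _ cmax] := @EVT_max R (fun t => `|derive1n b f t|) (-1) 1 ltac:(lra)
    (continuous_subspaceT cf).
  exists `|derive1n b f c| => t; have [t1|t1] := ltP 1 `|t|.
    by rewrite th0// normr0.
  by apply: cmax; rewrite in_itv/= -ler_norml.
Unshelve. all: by end_near.
Qed.
End smooth1.

(** * Derivatives of products of plane waves *)

Section calc.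
Local Open Scope classical_set_scope.
Local Open Scope ring_scope.

Context {R : realType} {n : nat}.
Local Notation Rn := 'rV[R]_n.

Lemma is_diff_prod (I : eqType) (r : seq I) (g : I -> Rn -> R)
    (dg : I -> Rn -> R) x :
  uniq r -> (forall i, is_diff x (g i) (dg i)) ->
  is_diff x (fun y => \prod_(i <- r) g i y)
    (fun h => \sum_(i <- r) dg i h * \prod_(j <- r | j != i) g j x).
Proof.
move=> + gx; elim: r => [_|i r IHr /andP[ir ur]].
  under eq_fun do rewrite big_nil.
  under [X in is_diff _ _ X]eq_fun do rewrite big_nil.
  exact: is_diff_cst.
under eq_fun do rewrite big_cons.
have -> : (fun h => \sum_(j <- i :: r) dg j h * \prod_(k <- i :: r | k != j) g k x) =
    (fun h => g i x * \sum_(j <- r) dg j h * \prod_(k <- r | k != j) g k x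
     + (\prod_(j <- r) g j x) * dg i h).
  apply/funext => h; rewrite big_cons addrC; congr (_ + _).
    rewrite mulr_sumr; apply: eq_big_seq => j jr.
    by rewrite big_cons ifT; [rewrite mulrCA|apply: contraNneq ir => ->].
  rewrite mulrC big_cons eqxx; congr (_ * _); rewrite big_seq_cond [RHS]big_seq.
  by apply: eq_bigl => j; case: eqVneq => [->|]; rewrite ?(negPf ir)// andbT.
have := IHr ur => dr.
exact: is_diffM.
Qed.

Lemma is_diff_scalev (V : normedModType R) (f df : Rn -> R) (v : V) x :
  is_diff x f df -> is_diff x (fun y => f y *: v) (fun h => df h *: v).
Proof.
move=> fx; have fd : differentiable f x by exact: ex_diff.
split; first exact: differentiableZl.
by rewrite diffZl// diff_val.
Qed.

Lemma is_diff_sumr (V : normedModType R) d (f df : 'I_d -> Rn -> V) x :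
  (forall i, is_diff x (f i) (df i)) ->
  is_diff x (fun y => \sum_i f i y) (fun h => \sum_i df i h).
Proof.
elim: d f df => [|d IHd] f df fx.
  under eq_fun do rewrite big_ord0.
  under [X in is_diff _ _ X]eq_fun do rewrite big_ord0.
  exact: is_diff_cst.
under eq_fun do rewrite big_ord_recl.
under [X in is_diff _ _ X]eq_fun do rewrite big_ord_recl.
have := IHd (fun i => f (lift ord0 i)) (fun i => df (lift ord0 i))
  (fun i => fx _) => dr.
exact: is_diffD.
Qed.

Definition linform (a x : Rn) : R := \sum_j x 0 j * a 0 j.

Lemma is_diff_linform (a x : Rn) : is_diff x (linform a) (linform a).
Proof.
have coord j : is_diff x (fun y : Rn => y 0 j : R) (fun y : Rn => y 0 j : R).
  have c_lin : linear (fun y : Rn => y 0 j : R) by move=> c u v; rewrite !mxE.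
  pose c : {linear Rn -> R} := HB.pack (fun y : Rn => y 0 j : R)
    (GRing.isLinear.Build _ _ _ _ _ c_lin).
  split; first exact: differentiable_coord.
  exact: (@diff_lin _ _ _ c x (@coord_continuous _ _ _ _ _)).
exact: (@is_diff_sumr _ _ _ _ _ (fun j => is_diff_scalev (a 0 j) (coord j))).
Qed.

Lemma is_diff_plane_wave (a x : Rn) (f df : R -> R) :
  (forall t, is_derive t (1 : R) f (df t)) ->
  is_diff x (fun y => f (linform a y)) (fun h => linform a h * df (linform a x)).
Proof.
move=> fdf; have lin := is_diff_linform a x.
have fd : is_diff (linform a x) f ( *:%R^~ (df (linform a x))).
  have := fdf (linform a x) => ft.
  have dft : derivable f (linform a x) (1 : R) by exact: ex_derive.
  split; first exact/derivable1_diffP.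
  by rewrite deriv1E// derive1E derive_val.
exact: is_diff_comp.
Qed.

End calc.

Section plane_waves.
Context {R : realType} {n : nat}.
Local Notation Rn := 'rV[R]_n.
Variables (a : 'I_n -> Rn) (th : 'I_n -> nat -> R -> R).

(** The derivative [prod_i (d / dt_i) ^ (m i)] of the function
    [prod_i th i 0 t_i], evaluated at the linear forms [t_i = linform (a i) x]. *)
Definition wave (m : multinom n) (x : Rn) : R :=
  \prod_i th i (m i) (linform (a i) x).

(** The polynomial [q] read as a differential operator in the variables [t_i],
    applied to the product above.  Polynomials thus encode all the functions
    that successive derivatives can produce. *)
Definition act (x : Rn) (q : mpoly n R) : R :=
  \sum_(m <- msupp q) mcoeff m q * wave m x.

Lemma act_bounded_sum x q (d : nat) : (msize q <= d)%N ->
  act x q = \sum_(m : bmultinom n d) mcoeff m q * wave m x.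
Proof.
move=> qd; rewrite /act (big_mksub (bmultinom n d : subFinType _)) ?msupp_uniq //=.
  by rewrite big_rmcond //= => m /memN_msupp_eq0 ->; rewrite mul0r.
by move=> m /msize_mdeg_lt /leq_trans; apply.
Qed.

Lemma act_is_linear x : linear (act x).
Proof.
move=> c p q; pose d := maxn (msize (c *: p + q)) (maxn (msize p) (msize q)).
rewrite !(@act_bounded_sum x _ d) ?leq_max ?leqnn ?orbT//.
rewrite /GRing.scale/= mulr_sumr -big_split/=; apply: eq_bigr => m _.
by rewrite mcoeffD mcoeffZ mulrDl mulrA.
Qed.

HB.instance Definition _ x :=
  GRing.isLinear.Build R (mpoly n R) R _ (act x) (act_is_linear x).

Lemma act_monomial x m : act x (mpolyX R m) = wave m x.
Proof. by rewrite /act msuppX big_seq1 mcoeffX eqxx mul1r. Qed.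

(** The symbol of the derivative in the direction [h]: by the chain rule it acts
    as [sum_i linform (a i) h * d / dt_i]. *)
Definition dir_poly (h : Rn) : mpoly n R := \sum_i linform (a i) h *: mpolyX R (mnm1 i).

Hypothesis thD : forall i b t, is_derive t (1 : R) (th i b) (th i b.+1 t).

Lemma is_diff_wave m x :
  is_diff x (wave m) (fun h => act x (dir_poly h * mpolyX R m)).
Proof.
have dg i : is_diff x (fun y => th i (m i) (linform (a i) y))
    (fun h => linform (a i) h * th i (m i).+1 (linform (a i) x)).
  exact: is_diff_plane_wave.
have := is_diff_prod (index_enum_uniq 'I_n) dg; congr is_diff_def.
apply/funext => h; rewrite /dir_poly mulr_suml linear_sum /=; apply: eq_bigr => i _.
rewrite -[in RHS]scalerAl linearZ/= -mpolyXD act_monomial -mulrA; congr (_ * _).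
rewrite /wave [RHS](bigD1 i)//= mnmDE mnm1E eqxx add1n; congr (_ * _).
by apply: eq_bigr => j ji; rewrite mnmDE mnm1E eq_sym (negPf ji).
Qed.

Lemma is_diff_act q x :
  is_diff x (act^~ q) (fun h => act x (dir_poly h * q)).
Proof.
have := @is_diff_sumr _ _ R _ _ _ x (fun j : 'I_(size (msupp q)) =>
  is_diffZ (mcoeff (nth mnm0 (msupp q) j) q) (is_diff_wave (nth mnm0 (msupp q) j) x)).
congr is_diff_def.
  by apply/funext => y; rewrite /act (big_nth mnm0) big_mkord.
apply/funext => h; rewrite [in RHS](mpolyE q) mulr_sumr linear_sum/=.
rewrite [RHS](big_nth mnm0) big_mkord.
by apply: eq_bigr => j _; rewrite -scalerAr linearZ.
Qed.

Section vector_valued.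
Variables (V : normedModType R) (d : nat) (e : 'I_d -> V).

Definition wave_field (v : 'I_d -> mpoly n R) (x : Rn) : V :=
  \sum_c act x (v c) *: e c.

Lemma is_diff_wave_field v x :
  is_diff x (wave_field v) (fun h => wave_field (fun c => dir_poly h * v c) x).
Proof.
exact: (@is_diff_sumr _ _ V _ _ _ x (fun c =>
  is_diff_scalev (e c) (is_diff_act (v c) x))).
Qed.

Lemma derive_wave_field v h x :
  'D_h (wave_field v) x = wave_field (fun c => dir_poly h * v c) x.
Proof.
have dv := is_diff_wave_field v x.
rewrite deriveE; last exact: ex_diff.
by rewrite diff_val.
Qed.

End vector_valued.
End plane_waves.

Section plane_wave_fields.
Context {R : realType} {n : nat}.
Local Notation Rn := 'rV[R]_n.
Variables (a : 'I_n -> Rn) (th : 'I_n -> nat -> R -> R).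
Hypothesis thD : forall i b t, is_derive t (1 : R) (th i b) (th i b.+1 t).
Variables (V : euclideanType R) (d : nat) (e : 'I_d -> V).

Lemma iter_derive_wave_field hs v : iter_derive hs (wave_field a th e v) =
  wave_field a th e (fun c => (\prod_(h <- hs) dir_poly a h) * v c).
Proof.
elim: hs => [|h hs IHhs] /=.
  by congr wave_field; apply/funext => c; rewrite big_nil mul1r.
rewrite IHhs; apply/funext => x; rewrite derive_wave_field//.
by congr wave_field; apply/funext => c; rewrite big_cons mulrA.
Qed.

Lemma smooth_wave_field v : smooth (wave_field a th e v).
Proof.
move=> s; rewrite iter_derive_wave_field; split=> [x|i x].
  apply: differentiable_continuous.
  have := is_diff_wave_field a thD e _ x => h; exact: ex_diff.
apply: diff_derivable; have := is_diff_wave_field a thD e _ x => h; exact: ex_diff.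
Qed.

Lemma partial_wave_field k (al : multiindex n k) v : partial al (wave_field a th e v) =
  wave_field a th e (fun c => (\prod_i dir_poly a (ebasis i) ^+ val al i) * v c).
Proof.
rewrite /partial iter_derive_wave_field; congr wave_field; apply/funext => c.
congr (_ * _).
rewrite big_flatten big_map big_enum/=; apply: eq_bigr => i _.
by rewrite big_nseq iter_mulr_1.
Qed.

End plane_wave_fields.

Section plane_wave_bounds.
Context {R : realType} {n : nat}.
Local Notation Rn := 'rV[R]_n.
Variables (th : 'I_n -> nat -> R -> R).

(** The bound is uniform in the frequencies [a]: they only enter through the
    points at which the bounded functions [th i b] are evaluated. *)
Lemma act_bounded (q : mpoly n R) :
  (forall i b, exists C : R, forall t, `|th i b t| <= C) ->
  exists2 C : R, 0 <= C & forall (a : 'I_n -> Rn) x, `|act a th x q| <= C.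
Proof.
move=> thb; have /choice[C thC] (ib : 'I_n * nat) :
    exists C : R, forall t, `|th ib.1 ib.2 t| <= C.
  exact: thb.
have C0 ib : 0 <= C ib by exact: le_trans (normr_ge0 _) (thC ib 0).
exists (\sum_(m <- msupp q) `|mcoeff m q| * \prod_i C (i, m i)).
  by apply: sumr_ge0 => m _; rewrite mulr_ge0// prodr_ge0.
move=> a x; apply: le_trans (ler_norm_sum _ _ _) _; apply: ler_sum => m _.
rewrite normrM ler_wpM2l// normr_prod; apply: ler_prod => i _.
by rewrite normr_ge0 (thC (i, m i)).
Qed.

Lemma act_out (a : 'I_n -> Rn) (x : Rn) (i : 'I_n) q :
  (forall b t, 1 < `|t| -> th i b t = 0) -> 1 < `|linform (a i) x| ->
  act a th x q = 0.
Proof.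
move=> th0 ax; rewrite /act big1// => m _.
by rewrite /wave (bigD1 i)//= th0// mul0r mulr0.
Qed.

Lemma act_core (a : 'I_n -> Rn) (s : 'I_n -> R) (x : Rn) q :
  (forall i b t, `|t| < 2^-1 -> th i b t = s i ^+ b * expR (s i * t)) ->
  (forall i, `|linform (a i) x| < 2^-1) ->
  act a th x q = meval s q * \prod_i expR (s i * linform (a i) x).
Proof.
move=> thE ax; rewrite /act mevalE mulr_suml; apply: eq_bigr => m _.
by rewrite -mulrA /wave -big_split/=; congr (_ * _); apply: eq_bigr => i _; exact: thE.
Qed.

End plane_wave_bounds.

(** * Volumes of sheared boxes and the logarithmic divergence *)

Section shear.
Local Open Scope classical_set_scope.
Local Open Scope ring_scope.

Context {R : realType}.

Lemma measurable_linform n (a : 'rV[R]_n) :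
  measurable_fun [set: n.-tuple R] (fun t => \sum_j tnth t j * a 0 j).
Proof.
apply: measurable_sum => j; apply: measurable_funM => //.
exact: measurable_tnth.
Qed.

Definition slab_box n (L : 'M[R]_n) (b : 'I_n -> R) : set (n.-tuple R) :=
  [set t | forall i, `|\sum_j tnth t j * L i j| <= b i].

Lemma measurable_slab_box n (L : 'M[R]_n) b : measurable (slab_box L b).
Proof.
have -> : slab_box L b = \bigcap_(i in [set: 'I_n])
    ((fun t : n.-tuple R => \sum_j tnth t j * row i L 0 j) @^-1` `[- b i, b i]).
  apply/seteqP; split=> t /= tb i => [_|]; last first.
    have /= := tb i I; rewrite in_itv/= ler_norml.
    by under eq_bigr do rewrite mxE.
  by rewrite /= in_itv/= -ler_norml; under eq_bigr do rewrite mxE; exact: tb.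
apply: fin_bigcap_measurable => // i _; rewrite -[X in measurable X]setTI.
exact: measurable_linform.
Qed.

(** By Tonelli, slice at a fixed value of the last coordinates: every slice is a
    translate of the same interval. *)
Lemma shear_measure n (m : {sigma_finite_measure set (n.-tuple R) -> \bar R})
    (g : n.-tuple R -> R) (B : set (n.-tuple R)) (b : R) :
  measurable_fun setT g -> measurable B -> 0 <= b ->
  lebesgue_step m [set t | `|thead t + g [tuple of behead t]| <= b /\
    B [tuple of behead t]]
  = ((2 * b)%:E * m B)%E.
Proof.
move=> mg mB b0.
pose X : set (R * n.-tuple R) := [set xt | `|xt.1 + g xt.2| <= b /\ B xt.2].
have mX : measurable X.
  have -> : X = (fun xt => xt.1 + g xt.2) @^-1` `[- b, b] `&` snd @^-1` B.
    by apply/seteqP; split=> xt /=; rewrite /X/= in_itv/= -ler_norml.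
  apply: measurableI; rewrite -[X in measurable X]setTI; last exact: measurable_snd.
  have mgs : measurable_fun [set: R * n.-tuple R] (fun xt => xt.1 + g xt.2).
    by apply: measurable_funD => //; exact: measurableT_comp.
  exact: mgs.
rewrite /lebesgue_step /pushforward.
have -> : @tuple_cons R n @^-1` [set t | `|thead t + g [tuple of behead t]| <= b /\
    B [tuple of behead t]] = X.
  have tlE x (t : n.-tuple R) : [tuple of behead (x :: t)] = t by exact/val_inj.
  by apply/seteqP; split=> -[x t] /=; rewrite theadE tlE.
rewrite (@product_measure_unique _ _ _ _ _ lebesgue_measure m
  (lebesgue_measure \x^ m)%E)//; last first.
  by move=> C D mC mD; exact: product_measure2E.
transitivity (\int[m]_y (lebesgue_measure (ysection X y)))%E => //.
rewrite (eq_integral (fun y => ((2 * b)%:E * (\1_B y)%:E)%E)).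
  by rewrite ge0_integralZl_EFin//; [rewrite integral_indic// setIT|
    exact/measurable_EFinP/measurable_indic|lra].
move=> y _; rewrite indicE; have [yB|yB] := boolP (y \in B); last first.
  rewrite mule0 (_ : ysection X y = set0) ?measure0//.
  apply/seteqP; split=> // x; rewrite /ysection/= in_setE => -[_] /mem_set.
  by rewrite (negPf yB).
rewrite mule1 (_ : ysection X y = `[- b - g y, b - g y]%classic).
  rewrite lebesgue_measure_itv/= lte_fin; case: ltP => bb.
    by rewrite EFinB opprB; congr EFin; ring.
  by congr EFin; move: bb; rewrite lerD2r; lra.
have secE x : ysection X y x = X (x, y) by rewrite /ysection/= in_setE.
apply/seteqP; split=> x; rewrite secE /X/= in_itv/= ler_norml.
  by move=> [+ _]; rewrite lerBlDr lerBrDr.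
by rewrite lerBlDr lerBrDr => ->; split=> //; exact/set_mem.
Qed.

(** A unitriangular change of coordinates is a composition of shears, each of
    which moves one coordinate by a function of the following ones. *)
Lemma slab_box_measure n (L : 'M[R]_n) (b : 'I_n -> R) :
  (forall i j : 'I_n, (j < i)%N -> L i j = 0) -> (forall i, L i i = 1) ->
  (forall i, 0 <= b i) ->
  lebesgue_tuple n (slab_box L b) = (\prod_i (2 * b i))%:E.
Proof.
elim: n L b => [|n IHn] L b L0 L1 b0.
  by rewrite big_ord0 /= diracE mem_set//; case.
pose L' : 'M[R]_n := \matrix_(i, j) L (lift ord0 i) (lift ord0 j).
pose a' : 'rV[R]_n := \row_j L ord0 (lift ord0 j).
have tl (t : n.+1.-tuple R) i : tnth [tuple of behead t] i = tnth t (lift ord0 i).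
  by rewrite [in RHS](tuple_eta t) tnthS.
have -> : slab_box L b = [set t |
    `|thead t + \sum_j tnth [tuple of behead t] j * a' 0 j| <= b ord0 /\
    slab_box L' (fun i => b (lift ord0 i)) [tuple of behead t]].
  have e0 (t : n.+1.-tuple R) : \sum_j tnth t j * L ord0 j =
      thead t + \sum_j tnth [tuple of behead t] j * a' 0 j.
    rewrite big_ord_recl L1 mulr1; congr (_ + _).
    by apply: eq_bigr => j _; rewrite mxE tl.
  have eS (t : n.+1.-tuple R) i : \sum_j tnth t j * L (lift ord0 i) j =
      \sum_j tnth [tuple of behead t] j * L' i j.
    rewrite big_ord_recl L0// mulr0 add0r.
    by apply: eq_bigr => j _; rewrite mxE tl.
  apply/seteqP; split=> t /=; first by move=> tb; split=> [|i]; rewrite -?e0 -?eS.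
  by case=> t0 tb i; case: (unliftP ord0 i) => [j|] ->; rewrite ?e0 ?eS.
transitivity ((2 * b ord0)%:E *
    lebesgue_tuple n (slab_box L' (fun i => b (lift ord0 i))))%E.
  apply: (@shear_measure n (lebesgue_tuple n)
    (fun t => \sum_j tnth t j * a' 0 j)) => //.
  - exact: measurable_linform.
  - exact: measurable_slab_box.
rewrite IHn; first by rewrite big_ord_recl EFinM.
- by move=> i j ij; rewrite mxE L0.
- by move=> i; rewrite mxE.
- by move=> i.
Qed.
End shear.

Section estimates.
Local Open Scope classical_set_scope.
Local Open Scope ring_scope.

Context {R : realType}.

(** The integral of a nonnegative function is a supremum over the simple functions
    below it, hence monotone on arbitrary functions. *)
Lemma ge0_integral_mono d (T : measurableType d) (mu : {measure set T -> \bar R})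
    (f g : T -> \bar R) :
  (forall t, 0 <= f t)%E -> (forall t, f t <= g t)%E ->
  (\int[mu]_t f t <= \int[mu]_t g t)%E.
Proof.
move=> f0 fg; rewrite !ge0_integralTE//; last first.
  by move=> t; exact: le_trans (fg t).
by apply: le_ereal_sup => _ [h hf <-]; exists h => // t; exact: le_trans (fg t).
Qed.

Definition row_of_tuple n (t : n.-tuple R) : 'rV[R]_n := \row_i tnth t i.

Lemma linform_row_of_tuple n (a : 'rV[R]_n) t :
  linform a (row_of_tuple t) = \sum_j tnth t j * a 0 j.
Proof. by apply: eq_bigr => j _; rewrite mxE. Qed.

Lemma slab_boxE n (L : 'M[R]_n) b t :
  slab_box L b t <-> forall i, `|linform (row i L) (row_of_tuple t)| <= b i.
Proof.
have e i : linform (row i L) (row_of_tuple t) = \sum_j tnth t j * L i j.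
  by rewrite linform_row_of_tuple; apply: eq_bigr => j _; rewrite mxE.
by split=> tb i; have := tb i; rewrite e.
Qed.

Lemma integral_le_slab n (L : 'M[R]_n) (b : 'I_n -> R) (f : 'rV[R]_n -> R) (M : R) :
  (forall i j : 'I_n, (j < i)%N -> L i j = 0) -> (forall i, L i i = 1) ->
  (forall i, 0 <= b i) -> 0 <= M -> (forall x, 0 <= f x <= M) ->
  (forall x i, b i < `|linform (row i L) x| -> f x = 0) ->
  (integral_Rn f <= (M * \prod_i (2 * b i))%:E)%E.
Proof.
move=> L0 L1 b0 M0 fM f0; rewrite EFinM -(slab_box_measure L0 L1 b0).
rewrite -[X in (_ * lebesgue_tuple n X)%E]setIT -integral_indic//; last first.
  exact: measurable_slab_box.
rewrite -ge0_integralZl_EFin//; last first.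
  by apply/measurable_EFinP; apply: measurable_indic; exact: measurable_slab_box.
apply: ge0_integral_mono => t.
  by rewrite lee_fin; case/andP: (fM (row_of_tuple t)).
rewrite -EFinM lee_fin indicE; have [tb|] := boolP (t \in _).
  by rewrite mulr1; case/andP: (fM (row_of_tuple t)).
rewrite notin_setE mulr0 => tb.
suff [i ti] : exists i, b i < `|linform (row i L) (row_of_tuple t)|.
  by rewrite -/(row_of_tuple t) (f0 _ i).
apply: contrapT => /forallNP nb; apply: tb; apply/slab_boxE => i.
by rewrite leNgt; apply/negP; exact: nb.
Qed.

Lemma enorm_le_linforms n (L : 'M[R]_n) :
  (forall i j : 'I_n, (j < i)%N -> L i j = 0) -> (forall i, L i i = 1) ->
  exists2 K : R, 0 < K & forall x rho, 0 <= rho ->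
    (forall i, `|linform (row i L) x| <= rho) -> enorm x <= K * rho.
Proof.
move=> L0 L1; have Lu : L^T \in unitmx.
  rewrite unitmxE det_trig; last by apply/is_trig_mxP => i j ij; rewrite mxE L0.
  by rewrite big1 ?unitr1// => i _; rewrite mxE.
exists (1 + \sum_j \sum_i `|invmx L^T i j|).
  by rewrite ltr_wpDr// sumr_ge0// => j _; rewrite sumr_ge0.
move=> x rho rho0 xrho.
have xj j : `|x 0 j| <= (\sum_i `|invmx L^T i j|) * rho.
  rewrite -{1}[x](mulmxK Lu) mxE mulr_suml; apply: le_trans (ler_norm_sum _ _ _) _.
  apply: ler_sum => i _; rewrite normrM mulrC ler_wpM2l//.
  apply: le_trans (xrho i); rewrite le_eqVlt; apply/orP; left; apply/eqP.
  by rewrite mxE; congr `|_|; apply: eq_bigr => l _; rewrite !mxE.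
have sum0 : 0 <= \sum_j `|x 0 j| by rewrite sumr_ge0.
apply: (@le_trans _ _ (\sum_j `|x 0 j|)).
  rewrite /enorm -[leRHS]ger0_norm// -sqrtr_sqr ler_sqrt ?sqr_ge0//.
  rewrite expr2 mulr_suml; apply: ler_sum => j _.
  rewrite -real_normK ?num_real// expr2 ler_wpM2l//.
  by rewrite (bigD1 j)//= lerDl sumr_ge0.
apply: (@le_trans _ _ (\sum_j (\sum_i `|invmx L^T i j|) * rho)); first exact: ler_sum.
by rewrite -mulr_suml mulrDl mul1r lerDr.
Qed.

(** Only the largest scale [r] with [S r] counts, since a geometric sum of ratio
    at least [2] is at most twice its last term. *)
Lemma geometric_indicator_sum (q X : R) (S : nat -> bool) (N : nat) :
  2 <= q -> 0 <= X -> (forall r, (r < N)%N -> S r -> q ^+ r <= X) ->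
  \sum_(r < N) q ^+ r * (S r)%:R <= 2 * X.
Proof.
move=> q2 X0; elim: N => [|N IHN] SX; first by rewrite big_ord0 mulr_ge0.
rewrite big_ord_recr/=; case SN : (S N); last first.
  by rewrite mulr0 addr0 IHN// => r rN; apply: SX; rewrite ltnS ltnW.
have geo M : \sum_(r < M) q ^+ r <= q ^+ M.
  elim: M => [|M IHM]; first by rewrite big_ord0.
  rewrite big_ord_recr/= exprS; have qM : 0 <= q ^+ M by rewrite exprn_ge0//; lra.
  by have := ler_wpM2r qM q2; lra.
have SXN := SX N (leqnn _) SN; have geoN := geo N.
have le1 : \sum_(r < N) q ^+ r * (S r)%:R <= \sum_(r < N) q ^+ r.
  apply: ler_sum => r _; case: (S r); rewrite ?mulr1// mulr0 exprn_ge0//; lra.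
by rewrite mulr1; lra.
Qed.

(** In the box of half-width [2 ^ (- N - 2)] along [I] and [1 / 4] across, nest
    the boxes [S r] of half-width [2 ^ (- r - 2)] across, for [r <= N].  There
    [|x|] is at most a multiple of [2 ^ (- r)], so the weight dominates
    [sum_r 2 ^ (r p) 1_(S r)] up to a constant, and the volume of [S r] is
    proportional to [2 ^ (- r (n - #|I|))]: as [p >= n - #|I|], each of the
    [N + 1] scales contributes at least the same amount. *)
Lemma log_divergence n (L : 'M[R]_n) (I : {set 'I_n}) (p : R) :
  (forall i j : 'I_n, (j < i)%N -> L i j = 0) -> (forall i, L i i = 1) ->
  (0 < n)%N -> 1 <= p -> n%:R - p <= #|I|%:R ->
  exists2 c : R, 0 < c & forall (N : nat) (kap : R) (f : 'rV[R]_n -> R), 0 <= kap ->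
    (forall x, 0 <= f x) ->
    (forall x, (forall i, `|linform (row i L) x| <=
                 if i \in I then 2^-1 ^+ N.+2 else 2^-1 ^+ 2) ->
       kap / enorm x `^ p <= f x) ->
    ((kap * c * N.+1%:R * (2^-1 ^+ N) ^+ #|I|)%:E <= integral_Rn f)%E.
Proof.
move=> L0 L1 n0 p1 nIp; have [K K0 Kx] := enorm_le_linforms L0 L1.
pose q : R := 2 `^ p.
have In : (#|I| <= n)%N by rewrite -[leqRHS]card_ord max_card.
have q2 : 2 <= q by rewrite -[leLHS]powRr1// ler_powR// ler1n.
have Kp : 0 < K `^ p by rewrite powR_gt0.
exists ((2 * K `^ p)^-1 * 2^-1 ^+ n).
  by rewrite mulr_gt0 ?invr_gt0 ?mulr_gt0// exprn_gt0.
move=> N kap f kap0 f0 fx.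
pose b r i : R := if i \in I then 2^-1 ^+ N.+2 else 2^-1 ^+ r.+2.
have h0 k : 0 <= 2^-1 ^+ k :> R by rewrite exprn_ge0.
have b0 r i : 0 <= b r i by rewrite /b; case: ifP.
(* [Z] is the origin, where the quotient by [enorm x `^ p = 0] is zero by
   convention and no lower bound holds *)
pose Z := slab_box L (fun=> 0 : R).
pose S r := slab_box L (b r) `\` Z.
have mS r : measurable (S r) by apply: measurableD; exact: measurable_slab_box.
have muS r : ((2^-1 ^+ n * (2^-1 ^+ N) ^+ #|I| * (2^-1 ^+ r) ^+ (n - #|I|))%:E
    <= lebesgue_tuple n (S r))%E.
  have Z0 : lebesgue_tuple n Z = 0%E.
    rewrite slab_box_measure//; case: (n) n0 => // n' _.
    by rewrite big_ord_recl mulr0 mul0r.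
  have -> : 2^-1 ^+ n * (2^-1 ^+ N) ^+ #|I| * (2^-1 ^+ r) ^+ (n - #|I|) =
      \prod_i (2 * b r i).
    have h2 : 2 * 2^-1 = 1 :> R by rewrite divff.
    rewrite (bigID (mem I))/= (eq_bigr (fun=> 2^-1 * 2^-1 ^+ N)); last first.
      by move=> i iI; rewrite /b iI !exprS; lra.
    rewrite prodr_const (eq_bigr (fun=> 2^-1 * 2^-1 ^+ r)); last first.
      by move=> i /negPf iI; rewrite /b iI !exprS; lra.
    rewrite prodr_const -[X in _ = _ * _ ^+ X]/(#|[predC I]|).
    have nI : (#|I| + #|[predC I]|)%N = n by rewrite cardC card_ord.
    have -> : #|[predC I]| = (n - #|I|)%N.
      by have := congr1 (subn^~ #|I|) nI; rewrite /= addKn.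
    have -> : 2^-1 ^+ n = 2^-1 ^+ #|I| * 2^-1 ^+ (n - #|I|) :> R.
      by rewrite -exprD subnKC.
    by rewrite !exprMn; ring.
  rewrite -(slab_box_measure L0 L1 (b0 r)).
  have -> : lebesgue_tuple n (S r) = (lebesgue_tuple n (S r) + lebesgue_tuple n Z)%E.
    by rewrite Z0 adde0.
  apply: (@le_trans _ _ (lebesgue_tuple n (S r `|` Z))); last first.
    by apply: measureU2; [exact: mS|exact: measurable_slab_box].
  apply: le_measure; rewrite ?inE; [exact: measurable_slab_box| |].
    by apply: measurableU => //; exact: measurable_slab_box.
  by move=> t tb; have [tZ|tZ] := pselect (Z t); [right|left].
pose c := kap * (2 * K `^ p)^-1.
have c0 : 0 <= c by rewrite mulr_ge0// invr_ge0 mulr_ge0// ltW.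
have pointwise t : c * (\sum_(r < N.+1) q ^+ r * \1_(S r) t) <= f (row_of_tuple t).
  set x := row_of_tuple t.
  have [[r [rN tr]]|] := pselect (exists r, (r < N.+1)%N /\ S r t); last first.
    move=> /forallNP noS; rewrite big1 ?mulr0// => r _.
    by rewrite indicE memNset ?mulr0// => tr; apply: (noS r); split.
  have bS r' i : (r' < N.+1)%N -> S r' t -> `|linform (row i L) x| <= 2^-1 ^+ r'.+2.
    move=> rN' [/slab_boxE/(_ i) tb _]; apply: le_trans tb _; rewrite /b.
    by case: ifP => // _; apply: ler_wiXn2l; rewrite ?invr_ge0 ?invf_le1 ?ler1n.
  have x0 : 0 < enorm x.
    rewrite lt_neqAle sqrtr_ge0 andbT eq_sym; apply: contraPneq tr.2 => x0; apply.
    suff xj j : x 0 j = 0.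
      by apply/slab_boxE => i; rewrite /linform big1 ?normr0// => j _; rewrite xj mul0r.
    move/eqP: x0; rewrite sqrtr_eq0 => x0; apply/eqP.
    rewrite -sqrf_eq0 eq_le sqr_ge0 andbT.
    by apply: le_trans x0; rewrite (bigD1 j)//= lerDl sumr_ge0// => l _; exact: sqr_ge0.
  have xp : 0 < enorm x `^ p by rewrite powR_gt0.
  apply: (@le_trans _ _ (c * (2 * (K `^ p / enorm x `^ p)))).
    rewrite ler_wpM2l//; under eq_bigr do rewrite indicE.
    apply: (@geometric_indicator_sum _ _ (fun r => t \in S r)) => //.
      by rewrite divr_ge0// ltW.
    move=> r' rN'; rewrite in_setE => tr'; rewrite ler_pdivlMr//.
    have -> : q ^+ r' = (2 ^+ r') `^ p.
      by rewrite /q -powR_mulrn ?powR_ge0// -powRrM mulrC powRrM powR_mulrn.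
    rewrite -powRM ?exprn_ge0 ?(ltW x0)//; apply: ge0_ler_powR; rewrite ?nnegrE.
    - lra.
    - by rewrite mulr_ge0 ?exprn_ge0// ltW.
    - exact: ltW.
    have /= xK := Kx x _ (h0 r'.+2) (fun i => bS r' i rN' tr').
    apply: (@le_trans _ _ (2 ^+ r' * (K * 2^-1 ^+ r'.+2))).
      by rewrite ler_wpM2l ?exprn_ge0.
    have -> : 2 ^+ r' * (K * 2^-1 ^+ r'.+2) =
        K * (2^-1 * 2^-1) * (2 ^+ r' * 2^-1 ^+ r') by rewrite !exprS; ring.
    by rewrite -exprMn divff// expr1n mulr1 -invfM; lra.
  have -> : c * (2 * (K `^ p / enorm x `^ p)) = kap / enorm x `^ p.
    by rewrite /c; field; rewrite !gt_eqF.
  apply: fx => i; have [/slab_boxE/(_ i) tb _] := tr; apply: le_trans tb _; rewrite /b.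
  by case: ifP => // _; apply: ler_wiXn2l; rewrite ?invr_ge0 ?invf_le1 ?ler1n.
have -> : kap * ((2 * K `^ p)^-1 * 2^-1 ^+ n) * N.+1%:R * (2^-1 ^+ N) ^+ #|I| =
    c * \sum_(r < N.+1) 2^-1 ^+ n * (2^-1 ^+ N) ^+ #|I|.
  by rewrite sumr_const card_ord /c -mulr_natr; ring.
have m1 r : measurable_fun setT (fun t => (q ^+ r * \1_(S r) t)%:E).
  by apply/measurable_EFinP; apply: measurable_funM => //; exact: measurable_indic.
have q0 r : 0 <= q ^+ r by rewrite exprn_ge0//; lra.
apply: (@le_trans _ _ (\int[lebesgue_tuple n]_t
    (c * (\sum_(r < N.+1) q ^+ r * \1_(S r) t))%:E)%E); last first.
  apply: ge0_integral_mono => t; rewrite lee_fin//.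
  by rewrite mulr_ge0// sumr_ge0// => r _; rewrite mulr_ge0.
under eq_integral do rewrite EFinM -sumEFin.
rewrite ge0_integralZl_EFin//; last 2 first.
- by move=> t _; apply: sume_ge0 => r _; rewrite lee_fin mulr_ge0.
- by apply: emeasurable_sum => r; exact: m1.
rewrite ge0_integral_sum//; last by move=> r t _; rewrite lee_fin mulr_ge0.
rewrite EFinM lee_wpmul2l ?lee_fin// -sumEFin; apply: lee_sum => r _.
under eq_integral do rewrite EFinM.
rewrite ge0_integralZl_EFin ?integral_indic ?setIT//; last first.
  by apply/measurable_EFinP; exact: measurable_indic.
apply: (@le_trans _ _ ((q ^+ r)%:E * (2^-1 ^+ n * (2^-1 ^+ N) ^+ #|I| *
    (2^-1 ^+ r) ^+ (n - #|I|))%:E)%E); last by rewrite lee_wpmul2l ?lee_fin.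
rewrite -EFinM lee_fin mulrCA ler_peMr//.
(* [2 ^ (n - #|I|) <= q] since [n - #|I| <= p] *)
have nq : 2 ^+ (n - #|I|) <= q.
  by rewrite -powR_mulrn// /q ler_powR ?ler1n// natrB//; lra.
rewrite -exprM mulnC exprM -exprMn exprn_ege1//.
by rewrite exprVn ler_pdivlMr ?exprn_gt0// mul1r.
Qed.
End estimates.


(** * The symbol as a matrix of polynomials *)

Section symbol_matrix.
Context {R : realType} {n k : nat} {V E : euclideanType R}.
Variable A : multiindex n k -> 'Hom(V, E).
Local Notation eV := (vbasis {:V}).
Local Notation eE := (vbasis {:E}).
Local Notation dV := (\dim {:V}).
Local Notation dE := (\dim {:E}).

Definition opcoef al (c : 'I_dV) (l : 'I_dE) : R := coord eE l (A al eV`_c).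

(** Stated over an arbitrary ring [S], with [f] the embedding of the constants,
    because the symbol is evaluated at real points, at polynomials, and at
    polynomials that depend on an extra parameter. *)
Definition symbol_entry (S : comNzRingType) (f : R -> S) (x : 'I_n -> S) c l : S :=
  \sum_al f (opcoef al c l) * \prod_j x j ^+ val al j.

Lemma eq_symbol_entry (S : comNzRingType) (f g : R -> S) (x y : 'I_n -> S) c l :
  f =1 g -> x =1 y -> symbol_entry f x c l = symbol_entry g y c l.
Proof.
move=> fg xy; apply: eq_bigr => al _; rewrite fg; congr (_ * _).
by apply: eq_bigr => j _; rewrite xy.
Qed.

Lemma rmorph_symbol_entry (S T : comNzRingType) (g : {rmorphism S -> T}) f x c l :
  g (symbol_entry f x c l) = symbol_entry (g \o f) (g \o x) c l.
Proof.
rewrite rmorph_sum; apply: eq_bigr => al _; rewrite rmorphM rmorph_prod.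
by congr (_ * _); apply: eq_bigr => j _; rewrite rmorphXn.
Qed.

Lemma symbol_entryZ (S : comNzRingType) f (a : S) x c l :
  symbol_entry f (fun j => a * x j) c l = a ^+ k * symbol_entry f x c l.
Proof.
rewrite mulr_sumr; apply: eq_bigr => al _.
under eq_bigr do rewrite exprMn.
rewrite big_split/= prodrXr (eqP (valP al)); ring.
Qed.

Lemma coord_symbol xi (c : 'I_dV) l :
  coord eE l (symbol A xi eV`_c) = symbol_entry idfun (xi 0) c l.
Proof.
rewrite /symbol sum_lfunE linear_sum; apply: eq_bigr => al _.
by rewrite scale_lfunE linearZ /= mulrC.
Qed.

Lemma vbasis_sum (W : euclideanType R) (w : W) :
  w = \sum_(c < \dim {:W}) coord (vbasis {:W}) c w *: (vbasis {:W})`_c.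
Proof. by rewrite -coord_vbasis ?memvf. Qed.

(** In bases of [V] and [E], the symbol at the generic point [x] is a matrix of
    polynomials whose values are the symbols at the points [x(s)]. *)
Lemma symbol_kernel_field (x : 'I_n -> mpoly n R) :
  (forall s : 'I_n -> R,
    exists2 w : V, w != 0 & symbol A (\row_j meval s (x j)) w = 0) ->
  exists2 v : 'I_dV -> mpoly n R, exists c, v c != 0 &
    forall l, \sum_c symbol_entry (@mpolyC n R) x c l * v c = 0.
Proof.
move=> kerA; pose M := \matrix_(c, l) symbol_entry (@mpolyC n R) x c l.
have [|v v0 vM] := @poly_row_kernel _ _ _ _ M.
  move=> s; have [w w0 Aw] := kerA s.
  exists (\row_c coord eV c w).
    apply: contra w0 => /eqP/rowP w0; rewrite [w]vbasis_sum; apply/eqP.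
    by rewrite big1// => c _; have := w0 c; rewrite !mxE => ->; rewrite scale0r.
  apply/rowP => l; rewrite !mxE.
  transitivity (\sum_c coord eV c w *
      coord eE l (symbol A (\row_j meval s (x j)) eV`_c)); last first.
    rewrite -[RHS](linear0 (coord eE l)) -Aw [in RHS](vbasis_sum w) !linear_sum.
    by apply: eq_bigr => c _; rewrite !linearZ.
  apply: eq_bigr => c _; rewrite coord_symbol !mxE; congr (_ * _).
  rewrite rmorph_symbol_entry; apply: eq_symbol_entry => [r|j] /=.
    by rewrite mevalC.
  by rewrite mxE.
exists (v 0).
  apply: contrapT => /forallNP vc0; move/negP: v0; apply; apply/eqP/rowP => c.
  by rewrite mxE; apply/eqP; apply: contraT => /vc0.
move=> l; have /rowP/(_ l) := vM; rewrite !mxE => vMl.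
by rewrite -[RHS]vMl; apply: eq_bigr => c _; rewrite !mxE mulrC.
Qed.

Lemma diff_op_wave_field (a : 'I_n -> 'rV[R]_n) th v x :
  (forall i b t, is_derive t (1 : R) (th i b) (th i b.+1 t)) ->
  diff_op A (wave_field a th (fun c : 'I_dV => eV`_c) v) x =
  \sum_l act a th x (\sum_c symbol_entry (@mpolyC n R)
    (fun j => dir_poly a (ebasis j)) c l * v c) *: eE`_l.
Proof.
move=> thD; rewrite /diff_op.
have AE al (c : 'I_dV) : A al eV`_c = \sum_l opcoef al c l *: eE`_l.
  by rewrite {1}[A al _]vbasis_sum.
under eq_bigr => al _.
  rewrite partial_wave_field// /wave_field linear_sum/=.
  under eq_bigr => c _ do rewrite linearZ/= AE scaler_sumr.
  rewrite exchange_big; over.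
rewrite exchange_big; apply: eq_bigr => l _; rewrite exchange_big/=.
rewrite linear_sum scaler_suml/=; apply: eq_bigr => c _.
rewrite mulr_suml linear_sum scaler_suml; apply: eq_bigr => al _.
by rewrite scalerA -mulrA mul_mpolyC linearZ/= mulrC.
Qed.

End symbol_matrix.

(** * Fields squeezed around a subspace *)

Section squeezing.
Local Open Scope classical_set_scope.
Local Open Scope ring_scope.

Context {R : realType} {n k : nat} {V E : euclideanType R}.
Variable A : multiindex n k -> 'Hom(V, E).
Variables (I : {set 'I_n}) (L : 'M[R]_n).
Hypothesis L0 : forall i j : 'I_n, (j < i)%N -> L i j = 0.
Hypothesis L1 : forall i, L i i = 1.
Variables (th : 'I_n -> nat -> R -> R).
Hypothesis thD : forall i b t, is_derive t (1 : R) (th i b) (th i b.+1 t).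
Hypothesis thout : forall i b t, 1 < `|t| -> th i b t = 0.
Hypothesis thb : forall i b, exists C : R, forall t, `|th i b t| <= C.
Variable v : 'I_(\dim {:V}) -> mpoly n R.
Local Notation Rn := 'rV[R]_n.

(** Frequencies [lam] along the rows of index in [I], which will lie in the given
    subspace, and [1] along the others. *)
Definition freq (lam : R) (i : 'I_n) : Rn := (if i \in I then lam else 1) *: row i L.

(** [xiI] and [xiJ] are the two parts of the generic frequency
    [sum_i X_i *: row i L]: the part in the subspace, amplified by [lam], and
    the transversal one. *)
Definition xiI (j : 'I_n) : mpoly n R :=
  \sum_(i in I) L i j *: mpolyX R (mnm1 i).

Definition xiJ (j : 'I_n) : mpoly n R :=
  \sum_(i | i \notin I) L i j *: mpolyX R (mnm1 i).

Lemma linformZl (c : R) (a x : Rn) : linform (c *: a) x = c * linform a x.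
Proof. by rewrite mulr_sumr; apply: eq_bigr => j _; rewrite mxE mulrCA. Qed.

Lemma dir_poly_freq lam j : dir_poly (freq lam) (ebasis j) = lam *: xiI j + xiJ j.
Proof.
have lE i : linform (freq lam i) (ebasis j) = (if i \in I then lam else 1) * L i j.
  rewrite linformZl; congr (_ * _); rewrite /linform (bigD1 j)//= big1 ?addr0.
    by rewrite !mxE !eqxx mul1r.
  by move=> l /negPf lj; rewrite !mxE lj mul0r.
rewrite /dir_poly (bigID (mem I))/= scaler_sumr; congr (_ + _); apply: eq_bigr => i.
  by move=> iI; rewrite lE iI scalerA.
by move=> /negPf iI; rewrite lE iI mul1r.
Qed.

Definition squeezed lam : Rn -> V :=
  wave_field (freq lam) th (fun c : 'I_(\dim {:V}) => (vbasis {:V})`_c) v.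

Lemma linform_continuous (a : Rn) : continuous (linform a).
Proof.
move=> x; apply: differentiable_continuous.
have := is_diff_linform a x => h; exact: ex_diff.
Qed.

Lemma squeezed_test_function lam : 1 <= lam -> test_function (squeezed lam).
Proof.
move=> lam1; split; first exact: smooth_wave_field.
have [K K0 Kx] := enorm_le_linforms L0 L1.
pose B : set Rn := [set x | forall i, `|linform (freq lam i) x| <= 1].
have clB : closed B.
  have -> : B = \bigcap_i (linform (freq lam i) @^-1` [set t | `|t| <= 1]).
    by apply/seteqP; split=> x xB i; [move=> _; exact: xB|exact: (xB i Logic.I)].
  apply: closed_bigI => i _; apply: preimage_closed.
    by move=> x _; exact: linform_continuous.
  have -> : [set t : R | `|t| <= 1] = `[-1, 1]%classic.
    by apply/seteqP; split=> t /=; rewrite in_itv/= ler_norml.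
  exact: itv_closed.
have cpB : compact [set x : Rn | forall i, `[- K, K]%classic (x ord0 i)].
  by apply: (@rV_compact R n (fun=> `[- K, K]%classic)) => _; exact: segment_compact.
apply: (subclosed_compact (@closed_closure _ _) cpB).
have suppB : closure [set x | squeezed lam x != 0] `<=` B.
  move=> x; rewrite closureE => /(_ B); apply; split=> //= y.
  apply: contraNP => /existsNP[i yi]; rewrite /squeezed /wave_field big1// => c _.
  rewrite (@act_out _ _ _ _ _ i) ?scale0r//; first exact: thout.
  by rewrite ltNge; exact/negP.
move=> x /suppB xB i /=; rewrite in_itv/= -ler_norml.
have xK : enorm x <= K * 1.
  apply: Kx => // j; have := xB j; rewrite /freq linformZl normrM; case: ifP => _.
    by rewrite ger0_norm; [have := normr_ge0 (linform (row j L) x); nra|lra].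
  by rewrite normr1 mul1r.
rewrite mulr1 in xK; apply: le_trans xK; rewrite /enorm -sqrtr_sqr ler_sqrt.
  by rewrite (bigD1 i)//= lerDl sumr_ge0// => j _; exact: sqr_ge0.
by apply: sumr_ge0 => j _; exact: sqr_ge0.
Qed.

Lemma diff_op_squeezed_out lam x i : 1 < `|linform (freq lam i) x| ->
  diff_op A (squeezed lam) x = 0.
Proof.
move=> xi; rewrite diff_op_wave_field// big1// => l _.
by rewrite (@act_out _ _ _ _ _ i) ?scale0r//; exact: thout.
Qed.

(** The symbol of the operator on this field is [A(lam xiI + xiJ) v], that is,
    [lam ^ k] times [A(xiI + mu xiJ) v] with [mu = 1 / lam].  The latter is
    polynomial in [mu] and vanishes at [mu = 0] because [A(xiI) v = 0], so a
    factor [mu] comes out and one power of [lam] is gained. *)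
Lemma diff_op_squeezed_le : (0 < k)%N ->
  (forall l, \sum_c symbol_entry A (@mpolyC n R) xiI c l * v c = 0) ->
  exists2 M : R, 0 <= M & forall lam x, 1 <= lam ->
    `|diff_op A (squeezed lam) x| <= lam ^+ k.-1 * M.
Proof.
move=> k0 Av.
pose z j : {poly mpoly n R} := (xiI j)%:P + (xiJ j)%:P * 'X.
pose P l := \sum_c symbol_entry A (polyC \o @mpolyC n R) z c l * (v c)%:P.
have PE (mu : mpoly n R) l : (P l).[mu] =
    \sum_c symbol_entry A (@mpolyC n R) (fun j => xiI j + xiJ j * mu) c l * v c.
  rewrite horner_sum; apply: eq_bigr => c _; rewrite hornerM hornerC; congr (_ * _).
  rewrite -[LHS]/(horner_eval mu _) rmorph_symbol_entry; apply: eq_symbol_entry.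
    by move=> r; rewrite /= /horner_eval hornerC.
  by move=> j; rewrite /= /horner_eval /z !hornerE.
have /fin_all_exists[Q PQ] l : exists Q, P l = Q * 'X.
  have Pl0 : (P l).[0] = 0.
    transitivity (\sum_c symbol_entry A (@mpolyC n R) xiI c l * v c); last exact: Av.
    have xi0 : (fun j => xiI j + xiJ j * 0) = xiI.
      by apply/funext => j; rewrite mulr0 addr0.
    by rewrite PE xi0.
  have /factor_theorem[Q PQ] : root (P l) 0 by apply/rootP.
  by exists Q; rewrite PQ subr0.
have QE lam l : lam != 0 -> \sum_c symbol_entry A (@mpolyC n R)
      (fun j => dir_poly (freq lam) (ebasis j)) c l * v c =
    lam ^+ k.-1 *: (Q l).[mpolyC n lam^-1].
  move=> lam0; have -> : (fun j => dir_poly (freq lam) (ebasis j)) =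
      (fun j => mpolyC n lam * (xiI j + xiJ j * mpolyC n lam^-1)).
    apply/funext => j; rewrite dir_poly_freq mulrDr !mul_mpolyC; congr (_ + _).
    by rewrite [_ * mpolyC _ _]mulrC mul_mpolyC scalerA mulfV// scale1r.
  transitivity (lam ^+ k *: (P l).[mpolyC n lam^-1]).
    rewrite PE scaler_sumr; apply: eq_bigr => c _.
    by rewrite symbol_entryZ -rmorphXn -mulrA mul_mpolyC.
  rewrite PQ hornerM hornerX mulrC mul_mpolyC scalerA -[X in lam ^+ X](prednK k0).
  by rewrite exprSr mulfK.
have /choice[B B0] (q : mpoly n R) : exists C : R,
    0 <= C /\ forall (a : 'I_n -> Rn) x, `|act a th x q| <= C.
  by have [C C0 qC] := act_bounded q thb; exists C.
exists (\sum_l (\sum_(s < size (Q l)) B (Q l)`_s) * `|(vbasis {:E})`_l|).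
  apply: sumr_ge0 => l _; rewrite mulr_ge0// sumr_ge0// => s _.
  by have [] := B0 (Q l)`_s.
move=> lam x lam1; have lam0 : 0 < lam by lra.
rewrite diff_op_wave_field// mulr_sumr; apply: le_trans (ler_norm_sum _ _ _) _.
apply: ler_sum => l _; rewrite QE ?gt_eqF// normrZ mulrA ler_wpM2r//.
have lamk : 0 <= lam ^+ k.-1 by rewrite exprn_ge0// ltW.
have mu0 : 0 <= lam^-1 by rewrite invr_ge0 ltW.
have mu1 : lam^-1 <= 1 by rewrite invf_le1.
rewrite linearZ/= normrM (ger0_norm lamk) ler_wpM2l//.
rewrite horner_coef linear_sum; apply: le_trans (ler_norm_sum _ _ _) _.
apply: ler_sum => s _; rewrite -rmorphXn mulrC mul_mpolyC linearZ/= normrM.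
have [Bs0 /(_ (freq lam) x) Bs] := B0 (Q l)`_s; apply: le_trans Bs.
by rewrite ler_piMl// ger0_norm ?exprn_ge0// exprn_ile1.
Qed.

Lemma multilinear_norm_ge (W : euclideanType R) j (T : j.-tuple Rn -> W)
    (s : j.-tuple 'I_n) :
  `|T (map_tuple ebasis s)| <= multilinear_norm T.
Proof.
rewrite /multilinear_norm -[leLHS]ger0_norm// -sqrtr_sqr ler_sqrt.
  by rewrite (bigD1 s)//= lerDl sumr_ge0// => t _; exact: sqr_ge0.
by apply: sumr_ge0 => t _; exact: sqr_ge0.
Qed.

(** On the plateaus every polynomial [q] acts as multiplication by its value at
    [s], so this derivative is explicit. *)
Lemma squeezed_derivative_core (s : 'I_n -> R) (i0 : 'I_n) lam x :
  (forall i b t, `|t| < 2^-1 -> th i b t = s i ^+ b * expR (s i * t)) ->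
  (forall i, `|linform (freq lam i) x| < 2^-1) ->
  total_derivative k.-1 (squeezed lam) x (map_tuple ebasis (nseq_tuple k.-1 i0)) =
  ((lam * meval s (xiI i0) + meval s (xiJ i0)) ^+ k.-1 *
    \prod_i expR (s i * linform (freq lam i) x)) *:
  \sum_c meval s (v c) *: (vbasis {:V})`_c.
Proof.
move=> thE xcore.
rewrite /total_derivative /squeezed iter_derive_wave_field// /wave_field.
rewrite scaler_sumr; apply: eq_bigr => c _; rewrite scalerA; congr (_ *: _).
rewrite (act_core _ thE xcore) /= big_map big_nseq iter_mulr_1 dir_poly_freq.
by rewrite mevalM rmorphXn/= mevalD mevalZ; ring.
Qed.

(** The dominant factor of the explicit derivative is
    [(lam * sig + tau) ^ (k - 1)], where [sig] and [tau] are the values of [xiI i0]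
    and [xiJ i0] at [s]; its modulus is at least [lam * |sig| / 2] when
    [lam * |sig| >= 2 * |tau|]. *)
Lemma total_derivative_squeezed_ge (s : 'I_n -> R) (i0 : 'I_n) :
  (forall i b t, `|t| < 2^-1 -> th i b t = s i ^+ b * expR (s i * t)) ->
  meval s (xiI i0) != 0 -> (exists c, meval s (v c) != 0) ->
  exists2 c0 : R, 0 < c0 & exists lam0 : R, forall lam x, lam0 <= lam ->
    (forall i, `|linform (freq lam i) x| < 2^-1) ->
    lam ^+ k.-1 * c0 <= multilinear_norm (total_derivative k.-1 (squeezed lam) x).
Proof.
move=> thE sig0 [c1 vc1].
pose sig := meval s (xiI i0); pose tau := meval s (xiJ i0).
pose w : V := \sum_c meval s (v c) *: (vbasis {:V})`_c.
have w0 : 0 < `|w|.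
  rewrite normr_gt0; apply: contra vc1 => /eqP w0.
  have := congr1 (coord (vbasis {:V}) c1) w0.
  by rewrite coord_sum_free ?linear0 ?(basis_free (vbasisP _))// => ->.
pose e0 := \prod_i expR (- `|s i|).
have e00 : 0 < e0 by apply: prodr_gt0 => i _; exact: expR_gt0.
have sigp : 0 < `|sig| by rewrite normr_gt0.
exists ((`|sig| / 2) ^+ k.-1 * e0 * `|w|).
  by rewrite !mulr_gt0// exprn_gt0// divr_gt0.
exists (2 * `|tau| / `|sig|) => lam x lam0 xcore.
have lamp : 0 <= lam by apply: le_trans lam0; rewrite divr_ge0// mulr_ge0.
apply: le_trans (multilinear_norm_ge _ (nseq_tuple k.-1 i0)).
rewrite (squeezed_derivative_core _ thE xcore) normrZ normrM -/w !mulrA ler_wpM2r//.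
have ex : e0 <= `|\prod_i expR (s i * linform (freq lam i) x)|.
  rewrite normr_prod; apply: ler_prod => i _; rewrite expR_ge0 ger0_norm ?expR_ge0//=.
  rewrite ler_expR -lerN2 opprK; apply: le_trans (ler_norm _) _.
  rewrite normrN normrM ler_piMr// ltW// (lt_trans (xcore i))//; lra.
apply: ler_pM => //; first by rewrite mulr_ge0 ?exprn_ge0// divr_ge0.
  exact: ltW.
rewrite -exprMn normrX; apply: lerXn2r; rewrite ?nnegrE//.
  by rewrite mulr_ge0// divr_ge0.
have : 2 * `|tau| <= lam * `|sig| by rewrite -ler_pdivrMr.
have := lerB_normD (lam * sig) tau.
by rewrite normrM (ger0_norm lamp) -/sig -/tau; lra.
Qed.

End squeezing.

(** * Necessity of the injectivity condition *)

Theorem proposition4p2 (R : realType) (n k : nat) (hk : (0 < k)%N)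
    (V E : euclideanType R) (A : multiindex n k -> 'Hom(V, E))
    (p : R) (hp1 : 1 <= p) (hpn : p < n%:R) :
  (exists C : R, 0 < C /\
    forall u : 'rV[R]_n -> V, test_function u ->
      (integral_Rn (fun x =>
         (multilinear_norm (total_derivative k.-1 u x) `^ p / enorm x `^ p)%R)
       <= C%:E * integral_Rn (fun x => (`|diff_op A u x| `^ p)%R))%E) ->
  forall Pi : {vspace 'rV[R]_n}, n%:R - p <= (\dim Pi)%:R ->
    exists xi : 'rV[R]_n, xi \in Pi /\ injective (symbol A xi).
Proof.
move=> [C [C0 hardy]] Pi dimPi; apply: contrapT => /forallNP noinj.
have kerPi xi : xi \in Pi -> exists2 w : V, w != 0 & symbol A xi w = 0.
  move=> xiPi; apply: contrapT => /forall2NP now; apply: (noinj xi); split=> //.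
  move=> w1 w2 w12; apply/eqP; rewrite -subr_eq0; apply/negPn/negP => w0.
  have Aw : symbol A xi (w1 - w2) = 0 by rewrite linearB /= w12 subrr.
  by have [|] := now (w1 - w2).
have [I [L [L0 L1 LPi dimI]]] := echelon_basis Pi.
have n0 : (0 < n)%N by rewrite -(ltr_nat R); lra.
have nIp : n%:R - p <= #|I|%:R by rewrite (le_trans dimPi)// ler_nat.
have [i0 i0I] : exists i0, i0 \in I.
  by apply/set0Pn; rewrite -card_gt0 -(ltr_nat R); lra.
have [v [c1 vc1] Av] : exists2 v : 'I_(\dim {:V}) -> mpoly n R,
    exists c, v c != 0 &
    forall l, \sum_c symbol_entry A (@mpolyC n R) (xiI I L) c l * v c = 0.
  apply: symbol_kernel_field => s; apply: kerPi.
  have -> : \row_j meval s (xiI I L j) = \sum_(i in I) s i *: row i L.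
    apply/rowP => j; rewrite mxE summxE raddf_sum; apply: eq_bigr => i _.
    by rewrite /= mevalZ mevalXU !mxE mulrC.
  by apply: memv_suml => i iI; rewrite memvZ// LPi.
have xiI0 : xiI I L i0 != 0.
  apply/eqP => /(congr1 (mcoeff (mnm1 i0))); rewrite mcoeff0 raddf_sum (bigD1 i0)//=.
  rewrite mcoeffZ mcoeffX eqxx L1 mulr1 big1 ?addr0.
    by apply/eqP; exact: oner_neq0.
  move=> i /andP[_ ii0]; rewrite mcoeffZ mcoeffX.
  case: eqP => [|_]; last by rewrite mulr0.
  by move=> /mnmP/(_ i); rewrite !mnm1E eqxx eq_sym (negPf ii0).
(* [s] is chosen so that the leading part of the [k - 1]st derivative survives *)
have [s] := mpoly_nonroot (mulf_neq0 xiI0 vc1).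
rewrite mevalM mulf_eq0 negb_or => /andP[sI0 svc1].
have /choice[th thP] i := exponential_bump (s i).
have thD i : forall b t, is_derive t (1 : R) (th i b) (th i b.+1 t) by have [] := thP i.
have thE i : forall b t, `|t| < 2^-1 -> th i b t = s i ^+ b * expR (s i * t).
  by have [] := thP i.
have thO i : forall b t, 1 < `|t| -> th i b t = 0 by have [] := thP i.
have thB i : forall b, exists C : R, forall t, `|th i b t| <= C by have [] := thP i.
have [M M0 uM] := diff_op_squeezed_le thD thB hk Av.
have [c0 c00 [lam0 uc]] := @total_derivative_squeezed_ge R n k V I L th thD v
  s i0 thE sI0 (ex_intro _ c1 svc1).
have [c cp logdiv] := log_divergence L0 L1 n0 hp1 nIp.
(* the factors [lam ^ (k - 1)] and [lam ^ (- #|I|)], with [lam = 2 ^ N], occur on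
   both sides of the Hardy inequality and cancel *)
have bound N : lam0 <= 2 ^+ N -> (c0 `^ p * c) * N.+1%:R <= C * M `^ p * 2 ^+ n.
  move=> lamN; pose lam : R := 2 ^+ N.
  have lam1 : 1 <= lam by rewrite exprn_ege1// ler1n.
  have lamp : 0 < lam by lra.
  have hN : 2^-1 ^+ N = lam^-1 by rewrite exprVn.
  have lampow : 0 < lam ^+ k.-1 by rewrite exprn_gt0.
  have freqE i x : `|linform (freq I L lam i) x| =
      (if i \in I then lam else 1) * `|linform (row i L) x|.
    by rewrite linformZl normrM ger0_norm//; case: ifP => _ //; exact: ltW.
  pose u := squeezed I L th v lam.
  have lower : (((lam ^+ k.-1 * c0) `^ p * c * N.+1%:R * lam^-1 ^+ #|I|)%:E <=
      integral_Rn (fun x => (multilinear_norm (total_derivative k.-1 u x) `^ p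
        / enorm x `^ p)%R))%E.
    rewrite -hN; apply: logdiv => [|x|x xI]; first exact: powR_ge0.
      by rewrite divr_ge0// powR_ge0.
    rewrite ler_wpM2r ?invr_ge0 ?powR_ge0//; apply: ge0_ler_powR; rewrite ?nnegrE.
    - by lra.
    - by rewrite mulr_ge0// ltW.
    - exact: sqrtr_ge0.
    apply: uc => // i; have := xI i; rewrite freqE; case: ifP => _ xi.
      apply: (@le_lt_trans _ _ (lam * 2^-1 ^+ N.+2)); first by rewrite ler_wpM2l// ltW.
      have -> : lam * 2^-1 ^+ N.+2 = lam * lam^-1 * (2^-1 * 2^-1).
        by rewrite !exprS hN; ring.
      by rewrite mulfV ?gt_eqF// mul1r; lra.
    by move: xi; rewrite mul1r expr2 => xi; lra.
  have upper : (integral_Rn (fun x => (`|diff_op A u x| `^ p)%R) <=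
      ((lam ^+ k.-1 * M) `^ p * (2 ^+ n * lam^-1 ^+ #|I|))%:E)%E.
    have -> : 2 ^+ n * lam^-1 ^+ #|I| = \prod_i (2 * if i \in I then lam^-1 else 1).
      rewrite big_split/= prodr_const card_ord -prodr_const; congr (_ * _).
      exact: big_mkcond.
    apply: (@integral_le_slab R n L (fun i => if i \in I then lam^-1 else 1) _ _ L0 L1).
    - by move=> i /=; case: ifP => _ //; rewrite invr_ge0 ltW.
    - exact: powR_ge0.
    - move=> x; rewrite powR_ge0/=.
      apply: ge0_ler_powR; rewrite ?nnegrE//; first by lra.
        by rewrite mulr_ge0// ltW.
      exact: uM.
    - move=> x i xi; rewrite (@diff_op_squeezed_out _ _ _ _ _ A I L _ thD thO v lam x i).
        by rewrite normr0 powR0// gt_eqF//; lra.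
      rewrite freqE; move: xi; case: ifP => _; last by rewrite mul1r.
      by move=> xi; rewrite -ltr_pdivrMl ?mulr1.
  have := le_trans lower (le_trans
    (hardy _ (squeezed_test_function I L0 L1 thD thO v lam1))
    (lee_wpmul2l (ltW C0 : (0 <= C%:E)%E) upper)).
  rewrite -EFinM lee_fin !powRM ?(ltW lampow) ?(ltW c00)//.
  have d0 : 0 < (lam ^+ k.-1) `^ p * lam^-1 ^+ #|I|.
    by rewrite mulr_gt0 ?powR_gt0// exprn_gt0// invr_gt0.
  move=> ineq; rewrite -(ler_pM2r d0); apply: le_trans (le_trans ineq _).
    by rewrite le_eqVlt; apply/orP; left; apply/eqP; ring.
  by rewrite le_eqVlt; apply/orP; left; apply/eqP; ring.
pose d := c0 `^ p * c; have d0 : 0 < d by rewrite mulr_gt0// powR_gt0.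
pose X := C * M `^ p * 2 ^+ n / d.
pose N := maxn (Num.bound `|lam0|) (Num.bound `|X|).
have NX : X < N%:R.
  apply: le_lt_trans (ler_norm _) _; apply: lt_le_trans (archi_boundP (normr_ge0 _)) _.
  by rewrite ler_nat leq_maxr.
have Nlam : lam0 <= 2 ^+ N.
  apply: le_trans (ler_norm _) _; apply: le_trans (ltW (archi_boundP (normr_ge0 _))) _.
  apply: (@le_trans _ _ N%:R); first by rewrite ler_nat leq_maxl.
  by rewrite -natrX ler_nat ltnW// ltn_expl.
have := bound N Nlam; rewrite -/d mulrC -ler_pdivlMr// -/X; apply/negP.
by rewrite -ltNge (lt_trans NX)// ltr_nat.
Qed.
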